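(* Let $R=\mathbb{Z}$ or $\mathbb{F}_p$ ($p$ a prime), let $X$ be a set, and let $\tau\colon X\to \mathsf{T}^2_R(X)$ be a map of sets. If $\tau$ is admissible, then $d_\tau^2\equiv 0$, and the map $\mathsf{T}^1_R(X)\to C^1(\Delta(M_\tau);R)$ given by $q\mapsto(\mathbf{a}\mapsto q(\mathbf{a}))$ extends uniquely to a monomorphism $$\psi_X\colon (\mathsf{T}_R(X),d_\tau)\hookrightarrow (C^*(\Delta(M_\tau);R),d_\Delta)$$ of binomial cup-one dgas.
   Context: Free binomial algebra. For a set $X$, $\mathrm{Int}(\mathbb{Z}^X)=\{q\in\mathbb{Q}[X] : q(\mathbb{Z}^X)\subseteq\mathbb{Z}\}$, and $\mathrm{Int}(\mathbb{F}_p^X)$ is the quotient of $\mathrm{Int}(\mathbb{Z}^X)$ by the ideal generated by $\zeta_n(x)=\binom{x}{n}$ ($x\in X$, $n\ge p$), tensored with $\mathbb{F}_p$. Let $\mathfrak{m}_{X,R}\subset \mathrm{Int}(R^X)$ be the submodule of polynomials with zero constant term, and $\mathsf{T}_R(X)=T^*(\mathfrak{m}_{X,R})$ the tensor algebra over $R$, with product $\cup=\otimes$ and maps $a\cup_1 b=ab$ on $\mathsf{T}^1=\mathfrak{m}_{X,R}$, $(a\otimes b)\cup_1 c=ac\otimes b+a\otimes bc$, and $(a_1\otimes a_2)\circ(b_1\otimes b_2)=a_1b_1\otimes a_2b_2$. The map $d_\tau$. For every set map $\tau\colon X\to\mathsf{T}_R^2(X)$, $d_\tau\colon\mathsf{T}_R(X)\to\mathsf{T}_R(X)$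 denotes the unique degree-1 $R$-linear map with $d_\tau(x)=\tau(x)$ for $x\in X$ satisfying the graded Leibniz rule and the $\cup_1$–$d$ formula $d(a\cup_1 b)=-a\cup b-b\cup a+da\cup_1 b+db\cup_1 a-da\circ db$ for $a,b\in\mathsf{T}^1_R(X)$. The magma $M_\tau$. Let $M=M(X,R)$ be the set of all functions $\mathbf{a}\colon X\to R$; an element $q\in\mathrm{Int}(R^X)$ is evaluated at $\mathbf a$ to give $q(\mathbf a)\in R$. Write $\tau(x)=\sum_i p_{x,i}\otimes q_{x,i}$ with $p_{x,i},q_{x,i}\in\mathfrak{m}_{X,R}$, and define $\mu_\tau\colon M\times M\to M$ by $\mu_\tau(\mathbf a,\mathbf a')(x)=\mathbf a(x)+\mathbf a'(x)-\sum_i p_{x,i}(\mathbf a)q_{x,i}(\mathbf a')$. Then $M_\tau=(M,\mu_\tau)$ is a magma with two-sided unit the zero function. $\tau$ is called admissible if $\mu_\tau$ is associative. $\Delta(M_\tau)$ and its cochains. For a semigroup $M$, $\Delta(M)$ is the $\Delta$-set with one vertex whose $n$-simplices are the $n$-tuples $(a_1,\dots,a_n)\in M^n$, the edge from vertex $i$ to vertex $j$ ($i<j$) being $a_{i+1}\cdots a_j$ (so faces are as in the bar construction). $C^*(\Delta(M);R)$ is its simplicial cochain dga with the usual coboundary $d_\Delta$ (e.g. $(d_\Delta f)(a,a')=f(a)+f(a')-f(aa')$ for 1-cochains) and cup product (front face times back face). For a $\Delta$-set it is a binomial cup-one dga with $(f\cup_1 g)(e)=f(e)g(e)$ on 1-cochains,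 $(v\circ w)(s)=v(s)w(s)$ on 2-cochains, $\cup_1$ of decomposable 2-cochains with 1-cochains given by $(a\cup b)\cup_1 c=a\cup(b\cup_1 c)+(a\cup_1 c)\cup b$, and $\zeta_n(f)(e)=\binom{f(e)}{n}$ on 1-cochains. Binomial cup-one dga. A dga over $R$ is a graded $R$-algebra $A=\bigoplus_{i\ge0}A^i$ (product $\cup$) with a degree-one map $d$, $d^2=0$, satisfying the graded Leibniz rule. $D^2(A)\subset A^2$ is the span of all $a\cup b$, $a,b\in A^1$. A cup-one dga is a dga with $R$-linear maps $\cup_1\colon A^1\otimes_R A^1\to A^1$, $\cup_1\colon D^2(A)\otimes_R A^1\to A^2$, $\circ\colon D^2(A)\otimes_R D^2(A)\to D^2(A)$ such that: (i) $R\oplus A^1$ with $\cup_1$ as multiplication on $A^1$ is a commutative $R$-algebra with identity $1\in R$; (ii) $(a\cup b)\cup_1 c=a\cup(b\cup_1 c)+(a\cup_1 c)\cup b$ for $a,b,c\in A^1$; (iii) $(u\cup v)\circ(w\cup z)=(u\cup_1 w)\cup(v\cup_1 z)$; (iv) $a\cup_1 dc=a\cup c-c\cup a$ for $a\in A^1$, $c\in A^0$; (v) the $\cup_1$–$d$ formula holds for $a,b\in A^1$ with $da,db\in D^2(A)$. It is binomial if $A^0$ (under $\cup$) and $R\oplus A^1$ (under $\cup_1$) are $R$-binomial algebras: for $R=\mathbb Z$, torsion-free commutative rings containing $\zeta_n(a)=\binom{a}{n}$ for all $a$, $n>0$; for $R=\mathbb F_p$, commutative $\mathbb F_p$-algebras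 with $a^p=a$ for all $a$ (then $\zeta_n(a)=a(a-1)\cdots(a-n+1)/n!$ is defined for $1\le n\le p-1$). Morphisms are degree-preserving dga maps commuting with $\cup_1$ on $A^1$ and with the $\zeta_n$ on $A^1$. *)

(* Defs.v *)
From HB Require Import structures.
From mathcomp Require Import all_boot all_order all_algebra.
From mathcomp Require Import finmap.
From mathcomp Require Import boolp classical_sets functions.
From mathcomp.multinomials Require Import monalg.

Set Implicit Arguments.
Unset Strict Implicit.
Unset Printing Implicit Defensive.

Import GRing.Theory Num.Theory.
Local Open Scope ring_scope.
Local Open Scope quotient_scope.

Definition lspan (R : pzRingType) (V : lmodType R) (G : V -> Prop) : {pred V} :=
  fun v => `[< exists s : seq (R * V),
    (forall rg, rg \in s -> G rg.2) /\ v = \sum_(rg <- s) rg.1 *: rg.2 >].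

Lemma lspan_closed (R : pzRingType) (V : lmodType R) (G : V -> Prop) :
  subsemimod_closed (lspan G).
Proof.
split; first split.
- by apply/asboolP; exists [::]; rewrite big_nil.
- move=> u v /asboolP[s [Gs ->]] /asboolP[t [Gt ->]]; apply/asboolP.
  exists (s ++ t); rewrite big_cat; split=> // rg.
  by rewrite mem_cat => /orP[/Gs|/Gt].
move=> r u /asboolP[s [Gs ->]]; apply/asboolP.
exists [seq (r * rg.1, rg.2) | rg <- s]; split.
  by move=> _ /mapP[rg /Gs Grg ->].
by rewrite big_map scaler_sumr; apply: eq_bigr => rg _; rewrite scalerA.
Qed.

Section IntZ.
Variable X : choiceType.

Definition Qpoly := {malg rat[{cmonom X}]}.

HB.instance Definition _ := GRing.ComAlgebra.on Qpoly.

Definition meval (a : X -> rat) (m : {cmonom X}) : rat :=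
  \prod_(x <- finsupp m) a x ^+ m x.

Lemma meval_mmorphism a : mmorphism (meval a).
Proof.
have E (m : {cmonom X}) (D : {fset X}) : (finsupp m `<=` D)%fset ->
    meval a m = \prod_(x <- D) a x ^+ m x.
  move=> sub; rewrite /meval (big_fset_incl _ sub) // => x _.
  by rewrite -cmE_neq0 negbK => /eqP->; rewrite expr0.
split=> [m n|]; last by rewrite /meval mdom1 big_seq_fset0.
pose D := (finsupp m `|` finsupp n)%fset.
rewrite (E _ D) ?mdomD // (E m D) ?fsubsetUl // (E n D) ?fsubsetUr //.
by rewrite -big_split; apply: eq_bigr => x _; rewrite cmM exprD.
Qed.

HB.instance Definition _ a :=
  isMultiplicative.Build {cmonom X} rat (meval a) (meval_mmorphism a).

Definition qeval (a : X -> rat) (q : Qpoly) : rat := mmap idfun (meval a) q.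

HB.instance Definition _ a := GRing.RMorphism.copy (qeval a)
  (mmap (idfun : {rmorphism rat -> rat}) (meval a)).

Definition qvar (x : X) : Qpoly := << ucm x >>.

Definition qbinom (q : Qpoly) (n : nat) : Qpoly :=
  (n`!%:R : rat)^-1 *: \prod_(i < n) (q - i%:R).

Definition intvalued : {pred Qpoly} := fun q =>
  `[< forall a : X -> int, exists z : int, qeval (fun x => (a x)%:~R) q = z%:~R >].

Lemma intvalued_closed : subring_closed intvalued.
Proof.
split=> [|p q /asboolP zp /asboolP zq|p q /asboolP zp /asboolP zq];
    apply/asboolP => a; last 2 first.
- have [[y py] [z qz]] := (zp a, zq a).
  by exists (y - z); rewrite rmorphB /= py qz rmorphB.
- have [[y py] [z qz]] := (zp a, zq a).
  by exists (y * z); rewrite rmorphM /= py qz rmorphM.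
by exists 1; rewrite rmorph1.
Qed.

HB.instance Definition _ :=
  GRing.isSubringClosed.Build Qpoly intvalued intvalued_closed.

Record IntZ := MkIntZ { IntZ_val :> Qpoly; _ : IntZ_val \in intvalued }.

HB.instance Definition _ := [isSub for IntZ_val].
HB.instance Definition _ := [Choice of IntZ by <:].
HB.instance Definition _ := [SubChoice_isSubComNzRing of IntZ by <:].

Definition IntZ_scale (n : int) (q : IntZ) := q *~ n.

Lemma IntZ_scaleA m n q :
  IntZ_scale m (IntZ_scale n q) = IntZ_scale (m * n) q.
Proof. exact: mulrzA_C. Qed.
Lemma IntZ_scale1 : left_id 1 IntZ_scale. Proof. by []. Qed.
Lemma IntZ_scaleDr : right_distributive IntZ_scale +%R.
Proof. by move=> n q r; apply: mulrzDl. Qed.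
Lemma IntZ_scaleDl q : {morph IntZ_scale^~ q : m n / m + n}.
Proof. by move=> m n; apply: mulrzDr. Qed.

HB.instance Definition _ := GRing.Zmodule_isLmodule.Build int IntZ
  IntZ_scaleA IntZ_scale1 IntZ_scaleDr IntZ_scaleDl.

Lemma IntZ_scaleAl (n : int) (q r : IntZ) : n *: (q * r) = n *: q * r.
Proof. by rewrite /GRing.scale /= /IntZ_scale mulrzAl. Qed.

HB.instance Definition _ := GRing.Lmodule_isLalgebra.Build int IntZ IntZ_scaleAl.
HB.instance Definition _ := GRing.Lalgebra_isComAlgebra.Build int IntZ.

Definition IntZ_eval (q : IntZ) (a : X -> int) : int :=
  numq (qeval (fun x => (a x)%:~R) q).

Lemma IntZ_evalE q a : (IntZ_eval q a)%:~R = qeval (fun x => (a x)%:~R) q.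
Proof.
by case: q => q /= qZ; case: (asboolP _ qZ a) => z qz; rewrite /IntZ_eval /= qz numq_int.
Qed.

Lemma qeval_var a x : qeval a (qvar x) = a x.
Proof.
by rewrite /qeval mmapU mul1r /meval mdomU big_seq_fset1 cmUU.
Qed.

Lemma qvar_intvalued x : qvar x \in intvalued.
Proof. by apply/asboolP => a; exists (a x); rewrite qeval_var. Qed.

Definition IntZ_var (x : X) : IntZ := MkIntZ (qvar_intvalued x).

Definition IntZ_zero_const : {pred IntZ} := fun q => mcoeff mone (val q) == 0.

End IntZ.

Section IntF.
Variables (X : choiceType) (p : nat) (p_pr : prime p).

Definition IntF_gen (g : IntZ X) : Prop :=
  (exists x n, (p <= n)%N /\ val g = qbinom (qvar x) n) \/ g = p%:R.

(* The ideal (zeta_n(x), p) for x in X and n >= p: tensoring with F_p is the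
   quotient by p. *)
Definition IntF_ideal of prime p : {pred IntZ X} :=
  lspan (V := (IntZ X)^o) IntF_gen.

Lemma IntF_ideal_closed : idealr_closed (IntF_ideal p_pr).
Proof.
have [[S0 SD] SZ] := lspan_closed (V := (IntZ X)^o) IntF_gen.
split=> //; last by move=> a u v Su Sv; apply: SD => //; apply: SZ.
pose e (q : IntZ X) := qeval (fun=> 0) (IntZ_val q).
have eD u v : e (u + v) = e u + e v by rewrite -rmorphD.
have eM u v : e (u * v) = e u * e v by rewrite -rmorphM.
apply/asboolP => -[s [Gs /(congr1 e)]].
suff [z ->] : exists z : int,
    e (\sum_(rg <- s) rg.1 *: rg.2 : (IntZ X)^o) = p%:R * z%:~R.
  rewrite /e rmorph1 -[p%:R]/((p%:Z)%:~R) -rmorphM -[1]/(1%:~R).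
  move=> /eqP; rewrite eqr_int => /eqP pz.
  have := dvdz_mulr z (dvdzz p); rewrite -pz dvdz1 absz_nat => /eqP p1.
  by have := prime_gt1 p_pr; rewrite p1.
elim: s Gs => [|[r g] s IHs] Gs.
  by exists 0; rewrite big_nil /e !rmorph0 mulr0.
have [|z Ez] := IHs; first by move=> rg srg; apply: Gs; rewrite inE srg orbT.
rewrite big_cons eD Ez.
have [y ->] : exists y : int, e (r * g) = p%:R * y%:~R.
  rewrite eM; have [/= [x [n [le_pn Eg]]]|/= ->] := Gs _ (mem_head _ _); last first.
    exists (IntZ_eval r (fun=> 0)); rewrite IntZ_evalE mulrC.
    by rewrite -[e p%:R]/((qeval (fun=> 0) \o val) p%:R) rmorph_nat.
  exists 0; rewrite mulr0 /e {}Eg /qbinom -mul_malgC rmorphM rmorph_prod /=.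
  case: n le_pn => [|n _]; first by rewrite leqNgt prime_gt0.
  have qx0 : qeval (fun=> 0) (qvar x - (ord0 : 'I_n.+1)%:R) = 0.
    by rewrite subr0 qeval_var.
  by rewrite big_ord_recl qx0 mul0r !mulr0.
by exists (y + z); rewrite rmorphD mulrDr.
Qed.

HB.instance Definition _ :=
  isIdealr.Build (IntZ X) (IntF_ideal p_pr) IntF_ideal_closed.

Definition IntF := {ideal_quot (IntF_ideal p_pr : idealr (IntZ X))}.

HB.instance Definition _ := GRing.ComNzRing.on IntF.

End IntF.
Section IntFAlg.
Variables (X : choiceType) (p : nat) (p_pr : prime p).
Local Notation F := (IntF X p_pr).

Lemma IntF_pchar : (p%:R : F) = 0.
Proof.
rewrite -(rmorph_nat (\pi_F : {rmorphism IntZ X -> F})) /=.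
rewrite -(pi_zeror (s := F)); apply/eqP; rewrite -Quotient.idealrBE subr0.
apply/asboolP; exists [:: (1, p%:R)].
rewrite big_seq1 scale1r; split=> // rg; rewrite inE => /eqP->.
by right.
Qed.

Definition IntF_scale (c : 'F_p) (q : F) : F := q *+ c.

Lemma IntF_natrFp n (q : F) : q *+ (inZp n : 'F_p) = q *+ n.
Proof.
rewrite -[in LHS](mulr_natl q) -[in RHS](mulr_natl q); congr (_ * q).
rewrite [in RHS](divn_eq n p) natrD natrM IntF_pchar mulr0 add0r.
by rewrite /= (Fp_cast p_pr).
Qed.

Lemma IntF_scaleA a b q : IntF_scale a (IntF_scale b q) = IntF_scale (a * b) q.
Proof. by rewrite /IntF_scale IntF_natrFp -mulrnA mulnC. Qed.
Lemma IntF_scale1 : left_id 1 IntF_scale.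
Proof. by move=> q; rewrite /IntF_scale mulr1n. Qed.
Lemma IntF_scaleDr : right_distributive IntF_scale +%R.
Proof. by move=> a q r; rewrite /IntF_scale mulrnDl. Qed.
Lemma IntF_scaleDl q : {morph IntF_scale^~ q : a b / a + b}.
Proof. by move=> a b; rewrite /IntF_scale IntF_natrFp mulrnDr. Qed.

HB.instance Definition _ := GRing.Zmodule_isLmodule.Build 'F_p F
  IntF_scaleA IntF_scale1 IntF_scaleDr IntF_scaleDl.

Lemma IntF_scaleAl (a : 'F_p) (q r : F) : a *: (q * r) = a *: q * r.
Proof. by rewrite /GRing.scale /= /IntF_scale mulrnAl. Qed.

HB.instance Definition _ := GRing.Lmodule_isLalgebra.Build 'F_p F IntF_scaleAl.
HB.instance Definition _ := GRing.Lalgebra_isComAlgebra.Build 'F_p F.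

(* Evaluation at the lift of a with values in {0, .., p-1}: zeta_n vanishes there
   for n >= p, so the result does not depend on the representative. *)
Definition IntF_eval (q : F) (a : X -> 'F_p) : 'F_p :=
  (IntZ_eval (repr q) (fun x => (a x : nat)%:Z))%:~R.

Definition IntF_var (x : X) : F := \pi_F (IntZ_var x).

(* The image of the polynomials in Int(Z^X) with zero constant term. *)
Definition IntF_zero_const : {pred F} :=
  fun q => `[< exists2 r, r \in @IntZ_zero_const X & \pi_F r = q >].

End IntFAlg.

Inductive coef := CoefZ | CoefF (p : nat) of prime p.

Definition coef_ring (k : coef) : comNzRingType :=
  match k with CoefZ => int | CoefF p _ => 'F_p end.

Definition IntR (k : coef) (X : choiceType) : comAlgType (coef_ring k) :=
  match k with CoefZ => IntZ X | CoefF p p_pr => IntF X p_pr end.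

Definition IntR_eval (k : coef) (X : choiceType) : IntR k X -> (X -> coef_ring k) -> coef_ring k :=
  match k with
  | CoefZ => @IntZ_eval X
  | CoefF p p_pr => @IntF_eval X p p_pr
  end.

Definition IntR_var (k : coef) (X : choiceType) : X -> IntR k X :=
  match k with
  | CoefZ => @IntZ_var X
  | CoefF p p_pr => @IntF_var X p p_pr
  end.

Definition zero_const (k : coef) (X : choiceType) : {pred IntR k X} :=
  match k with
  | CoefZ => @IntZ_zero_const X
  | CoefF p p_pr => @IntF_zero_const X p p_pr
  end.

Section AugmentationIdeal.
Variables (k : coef) (X : choiceType).

Lemma IntZ_zero_constD (q r : IntZ X) : q \in @IntZ_zero_const X ->
  r \in @IntZ_zero_const X -> q + r \in @IntZ_zero_const X.
Proof.
by rewrite !unfold_in /= mcoeffD => /eqP-> /eqP->; rewrite addr0.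
Qed.

Lemma IntZ_zero_constM (q r : IntZ X) :
  r \in @IntZ_zero_const X -> q * r \in @IntZ_zero_const X.
Proof.
rewrite !unfold_in /= => /eqP r0.
by rewrite (rmorphM (mcoeff (mone : {cmonom X}))) /= r0 mulr0.
Qed.

Lemma zero_constM (q r : IntR k X) :
  r \in @zero_const k X -> q * r \in @zero_const k X.
Proof.
case: k q r => [|p p_pr] q r; first exact: IntZ_zero_constM.
move=> /asboolP[r' r'0 <-]; apply/asboolP.
exists (repr q * r'); first exact: IntZ_zero_constM.
by rewrite rmorphM /= reprK.
Qed.

Lemma zero_constD (q r : IntR k X) : q \in @zero_const k X ->
  r \in @zero_const k X -> q + r \in @zero_const k X.
Proof.
case: k q r => [|p p_pr] q r; first exact: IntZ_zero_constD.
move=> /asboolP[q' q'0 <-] /asboolP[r' r'0 <-]; apply/asboolP.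
by exists (q' + r'); [exact: IntZ_zero_constD | rewrite rmorphD].
Qed.

Lemma zero_const0 : 0 \in @zero_const k X.
Proof.
have Z0 : 0 \in @IntZ_zero_const X by rewrite unfold_in /= mcoeff0.
case: k => [|p p_pr]; first exact: Z0.
by apply/asboolP; exists 0 => //; rewrite rmorph0.
Qed.

Lemma zero_const_closed : submod_closed (@zero_const k X).
Proof.
split=> [|a q r q0 r0]; first exact: zero_const0.
by apply: zero_constD => //; rewrite -mulr_algl zero_constM.
Qed.

HB.instance Definition _ := GRing.isSubmodClosed.Build
  (coef_ring k) (IntR k X) (@zero_const k X) zero_const_closed.

Lemma IntR_var_zero_const x : IntR_var k x \in @zero_const k X.
Proof.
have Z0 : IntZ_var x \in @IntZ_zero_const X.
  by rewrite unfold_in /= mcoeffU cm1_eq1.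
by case: k => [|p p_pr]; [exact: Z0 | apply/asboolP; exists (IntZ_var x)].
Qed.

Record maug := MkMaug { maug_val :> IntR k X; _ : maug_val \in @zero_const k X }.

HB.instance Definition _ := [isSub for maug_val].
HB.instance Definition _ := [Choice of maug by <:].
HB.instance Definition _ := [SubChoice_isSubLmodule of maug by <:].

Definition maug_mul (q r : maug) : maug :=
  MkMaug (zero_constM (maug_val q) (valP r)).

Definition maug_var (x : X) : maug := MkMaug (IntR_var_zero_const x).

End AugmentationIdeal.

Section LmodQuotient.
Variables (R : pzRingType) (V : lmodType R) (G : V -> Prop).

Lemma lspan_submod_closed : submod_closed (lspan G).
Proof.
have [[S0 SD] SZ] := lspan_closed G.
by split=> // a u v Su Sv; apply: SD => //; apply: SZ.
Qed.

HB.instance Definition _ :=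
  GRing.isSubmodClosed.Build R V (lspan G) lspan_submod_closed.

Definition lquot := Quotient.quot (lspan G : zmodClosed V).

HB.instance Definition _ := GRing.Zmodule.on lquot.

Definition lquot_scale (a : R) (u : lquot) : lquot := \pi_lquot (a *: repr u).

Lemma lquot_scale_pi a v : lquot_scale a (\pi_lquot v) = \pi_lquot (a *: v).
Proof.
apply/eqP; rewrite /lquot_scale -Quotient.idealrBE -scalerBr.
have [_ SZ] := lspan_closed G; apply: SZ.
by rewrite Quotient.idealrBE reprK.
Qed.

Lemma lquotK (u : lquot) : \pi_lquot (repr u) = u.
Proof. exact: reprK. Qed.

Lemma lquot_scaleA a b u : lquot_scale a (lquot_scale b u) = lquot_scale (a * b) u.
Proof. by rewrite -[u]lquotK !lquot_scale_pi scalerA. Qed.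
Lemma lquot_scale1 : left_id 1 lquot_scale.
Proof. by move=> u; rewrite -[u]lquotK lquot_scale_pi scale1r. Qed.
Lemma lquot_scaleDr : right_distributive lquot_scale +%R.
Proof.
move=> a u v; rewrite -[u]lquotK -[v]lquotK.
rewrite -(raddfD (\pi_lquot : {additive V -> lquot})) !lquot_scale_pi.
by rewrite scalerDr raddfD.
Qed.
Lemma lquot_scaleDl u : {morph lquot_scale^~ u : a b / a + b}.
Proof.
by move=> a b; rewrite -[u]lquotK !lquot_scale_pi scalerDl raddfD.
Qed.

HB.instance Definition _ := GRing.Zmodule_isLmodule.Build R lquot
  lquot_scaleA lquot_scale1 lquot_scaleDr lquot_scaleDl.

End LmodQuotient.

Section TensorPower.
Variables (R : comNzRingType) (U : lmodType R).

Definition tset n (t : n.-tuple U) (i : 'I_n) (u : U) : n.-tuple U :=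
  [tuple if j == i then u else tnth t j | j < n].

(* tpow n is the n-th tensor power of U: the free module on U^n modulo the
   multilinearity relations; tens t is the class of u_1 (x) ... (x) u_n. *)
Definition tens_rel n (v : {malg R[n.-tuple U]}) : Prop :=
  exists t i (r : R) u u', v =
    << tset t i (r *: u + u') >> - r *: << tset t i u >> - << tset t i u' >>.

Definition tpow (n : nat) : lmodType R := lquot (@tens_rel n).

Definition tens n (t : n.-tuple U) : tpow n := \pi_(lquot _) << t >>.

(* The linear map induced by a multilinear f, computed on a representative; see
   tlift_spec for the independence of the choice. *)
Definition tlift n (W : lmodType R) (f : n.-tuple U -> W) (u : tpow n) : W :=
  let v : {malg R[n.-tuple U]} := repr u in \sum_(t <- msupp v) v@_t *: f t.

Definition multilinear n (W : lmodType R) (f : n.-tuple U -> W) : Prop :=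
  forall t i, linear (fun u => f (tset t i u)).

Lemma tlift_spec n (W : lmodType R) (f : n.-tuple U -> W) : multilinear f ->
  linear (tlift f) /\ forall t, tlift f (tens t) = f t.
Proof.
move=> f_lin; pose ext (v : {malg R[n.-tuple U]}) := \sum_(t <- msupp v) v@_t *: f t.
have extE v (D : {fset n.-tuple U}) : (msupp v `<=` D)%fset ->
    ext v = \sum_(t <- D) v@_t *: f t.
  by move=> sub; apply: big_fset_incl => // t _ /mcoeff_outdom->; rewrite scale0r.
have ext_lin : linear ext.
  move=> r u v; pose D := (msupp u `|` msupp v `|` msupp (r *: u + v))%fset.
  rewrite !(extE _ D) ?scaler_sumr -?big_split /=.
  - by apply: eq_bigr => t _; rewrite mcoeffD mcoeffZ scalerDl scalerA.
  - by rewrite /D fsubsetU // fsubsetUr.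
  - by rewrite /D fsubsetU // fsubsetUl.
  - by rewrite /D fsubsetUr.
have ext0 : ext 0 = 0 by rewrite /ext msupp0 big_seq_fset0.
have extZ r u : ext (r *: u) = r *: ext u by rewrite -[r *: u]addr0 ext_lin ext0 addr0.
have extD u v : ext (u + v) = ext u + ext v by rewrite -{1}[u]scale1r ext_lin scale1r.
have extN u : ext (- u) = - ext u by rewrite -(scaleN1r u) extZ scaleN1r.
have extU t : ext << t >> = f t.
  by rewrite /ext msuppU oner_eq0 big_seq_fset1 mcoeffUU scale1r.
have ext_rel v : v \in lspan (@tens_rel n) -> ext v = 0.
  move=> /asboolP[s [Gs ->]]; elim: s Gs => [|[r g] s IHs] Gs.
    by rewrite big_nil.
  rewrite big_cons extD extZ IHs; last first.
    by move=> rg srg; apply: Gs; rewrite inE srg orbT.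
  have [t [i [a [u [u' /= ->]]]]] := Gs _ (mem_head _ _).
  by rewrite !extD !extN extZ !extU f_lin addrAC addrK subrr scaler0 addr0.
have ext_pi v : tlift f (\pi_(lquot (@tens_rel n)) v) = ext v.
  apply/eqP; rewrite -subr_eq0 -extN -extD; apply/eqP/ext_rel.
  by rewrite Quotient.idealrBE; apply/eqP/reprK.
split=> [r u v|t]; last by rewrite ext_pi.
rewrite -[u in LHS]lquotK -[v in LHS]lquotK [_ *: _]lquot_scale_pi.
by rewrite -(raddfD (\pi_(lquot (@tens_rel n)) : {additive _ -> _})) ext_pi ext_lin.
Qed.

End TensorPower.

Section CupOne.
Variable R : comNzRingType.

(* cup21 and circ are total functions, but they are only meaningful (and only
   constrained below) on the span decomp = D^2(A) of the products of elements of
   degree 1. *)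
Record cupone_alg := CupOneAlg {
  gr :> nat -> lmodType R;
  gr1 : gr 0;
  cup : forall i j, gr i -> gr j -> gr (i + j);
  cup1 : gr 1 -> gr 1 -> gr 1;
  cup21 : gr 2 -> gr 1 -> gr 2;
  circ : gr 2 -> gr 2 -> gr 2
}.

Definition gcast (A : cupone_alg) m n (e : m = n) (x : A m) : A n :=
  ecast i (A i) e x.

Definition degree1_map (A : cupone_alg) := forall n, A n -> A n.+1.

Variables (A : cupone_alg) (d : degree1_map A).

Definition decomp : {pred A 2} :=
  lspan (fun w : A 2 => exists a b : A 1, w = cup a b).

Definition is_graded_algebra : Prop :=
  [/\ forall i j (b : A j), linear (fun a : A i => cup a b),
      forall i j (a : A i), linear (fun b : A j => cup a b),
      forall i j l (a : A i) (b : A j) (c : A l),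
        gcast (addnA i j l) (cup a (cup b c)) = cup (cup a b) c,
      forall i (a : A i), cup (gr1 A) a = a
    & forall i (a : A i), gcast (addn0 i) (cup a (gr1 A)) = a].

Definition graded_leibniz : Prop := forall i j (a : A i) (b : A j),
  d (cup a b) =
    cup (d a) b + (-1) ^+ i *: gcast (addnS i j) (cup a (d b)).

Definition cup1_d_formula (a b : A 1) : Prop :=
  d (cup1 a b) =
    - cup a b - cup b a + cup21 (d a) b + cup21 (d b) a - circ (d a) (d b).

Definition is_dga : Prop :=
  [/\ is_graded_algebra, forall n, linear (@d n),
      forall n (a : A n), d (d a) = 0 & graded_leibniz].

Definition comm_algebra (V : lmodType R) (e : V) (mul : V -> V -> V) : Prop :=
  [/\ commutative mul, associative mul, left_id e mul
    & forall v, linear (mul v)].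

(* R (+) A^1 with multiplication cup1 on A^1. *)
Definition unitized := (R^o * A 1)%type.
HB.instance Definition _ := GRing.Lmodule.on unitized.
Definition uone : unitized := (1, 0).
Definition umul (x y : unitized) : unitized :=
  (x.1 * y.1, x.1 *: y.2 + y.1 *: x.2 + cup1 x.2 y.2).

Definition cupone_ops_linear : Prop :=
  [/\ forall b : A 1, linear (fun a => cup1 a b),
      forall a : A 1, linear (fun b => cup1 a b),
      forall r v w (b : A 1), v \in decomp -> w \in decomp ->
        cup21 (r *: v + w) b = r *: cup21 v b + cup21 w b
    & forall w, w \in decomp -> linear (fun b => cup21 w b)].

Definition circ_ops_linear : Prop :=
  [/\ forall v w, v \in decomp -> w \in decomp -> circ v w \in decomp,
      forall r u v w, u \in decomp -> v \in decomp -> w \in decomp ->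
        circ (r *: u + v) w = r *: circ u w + circ v w
    & forall r u v w, u \in decomp -> v \in decomp -> w \in decomp ->
        circ w (r *: u + v) = r *: circ w u + circ w v].

Definition cupone_axioms : Prop :=
  [/\ comm_algebra uone umul,
      forall a b c : A 1,
        cup21 (cup a b) c = cup a (cup1 b c) + cup (cup1 a c) b,
      forall u v w z : A 1,
        circ (cup u v) (cup w z) = cup (cup1 u w) (cup1 v z),
      forall (a : A 1) (c : A 0), cup1 a (d c) = cup a c - cup c a
    & forall a b : A 1, d a \in decomp -> d b \in decomp -> cup1_d_formula a b].

Definition is_cupone_dga : Prop :=
  [/\ is_dga, cupone_ops_linear, circ_ops_linear & cupone_axioms].

End CupOne.

Section Binomial.
Variable k : coef.
Local Notation R := (coef_ring k).

Definition falling (V : lmodType R) (e : V) (mul : V -> V -> V) (a : V) (n : nat) : V :=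
  \big[mul/e]_(i < n) (a - e *+ i).

Definition binomial_algebra (V : lmodType R) (e : V) (mul : V -> V -> V) : Prop :=
  comm_algebra e mul /\
  match k with
  | CoefZ =>
      (forall (a : V) n, (0 < n)%N -> a *+ n = 0 -> a = 0) /\
      (forall (a : V) n, (0 < n)%N -> exists z, z *+ n`! = falling e mul a n)
  | CoefF p _ => forall a : V, \big[mul/e]_(i < p) a = a
  end.

Definition zeta_range (n : nat) : bool :=
  (0 < n)%N && match k with CoefZ => true | CoefF p _ => (n < p)%N end.

(* The unique solution z of n! z = a (a - 1) .. (a - n + 1) in a binomial algebra
   (for n in zeta_range). *)
Definition zeta (V : lmodType R) (e : V) (mul : V -> V -> V) (n : nat) (a : V) : V :=
  xget 0 [set z | z *+ n`! = falling e mul a n].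

Definition zeta1 (A : cupone_alg R) (n : nat) (a : A 1) : A 1 :=
  (zeta (uone A) (@umul R A) n (0, a)).2.

Definition is_binomial_cupone_dga (A : cupone_alg R) (d : degree1_map A) : Prop :=
  [/\ is_cupone_dga d,
      binomial_algebra (gr1 A) (fun a b : A 0 => cup a b : A 0)
    & binomial_algebra (uone A) (@umul R A)].

Definition is_morphism (A B : cupone_alg R) (dA : degree1_map A)
    (dB : degree1_map B) (f : forall n, A n -> B n) : Prop :=
  [/\ (forall n, linear (@f n)) /\ f 0 (gr1 A) = gr1 B,
      forall i j (a : A i) (b : A j), f _ (cup a b) = cup (f _ a) (f _ b),
      forall n (a : A n), f _ (dA _ a) = dB _ (f _ a),
      forall a b : A 1, f _ (cup1 a b) = cup1 (f _ a) (f _ b)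
    & forall n (a : A 1), zeta_range n -> f _ (zeta1 n a) = zeta1 n (f _ a)].

End Binomial.

Section BarCochains.
Variables (R : comNzRingType) (M : Type) (op : M -> M -> M).

Definition simplex (n : nat) := 'I_n -> M.

(* The i-th face of (a_1, .., a_{n+1}): a_1 is dropped for i = 0, a_{n+1} for
   i = n + 1, and a_i, a_{i+1} are replaced by their product otherwise. *)
Definition bar_face n (i : 'I_n.+2) (s : simplex n.+1) : simplex n := fun j =>
  let a := s (widen_ord (leqnSn n) j) in
  let a' := s (lift ord0 j) in
  if (j.+1 < i)%N then a else if j.+1 == i :> nat then op a a' else a'.

Definition cochain (n : nat) : lmodType R := simplex n -> R^o.

Definition bar_d n (f : cochain n) : cochain n.+1 := fun s =>
  \sum_(i < n.+2) (-1) ^+ i * f (bar_face i s).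

Definition cochain_cup i j (f : cochain i) (g : cochain j) : cochain (i + j) :=
  fun s => f (fun l => s (lshift j l)) * g (fun l => s (rshift i l)).

Definition cochain_cup1 (f g : cochain 1) : cochain 1 := fun s => f s * g s.

(* On w = a U b this is a U (b U_1 c) + (a U_1 c) U b, and it is linear in w. *)
Definition cochain_cup21 (w : cochain 2) (c : cochain 1) : cochain 2 := fun s =>
  w s * (c (fun=> s ord0) + c (fun=> s ord_max)).

Definition cochain_circ (v w : cochain 2) : cochain 2 := fun s => v s * w s.

Definition bar_cochains : cupone_alg R :=
  @CupOneAlg R cochain (fun=> 1) cochain_cup cochain_cup1 cochain_cup21 cochain_circ.

End BarCochains.

Section TensorAlgebra.
Variables (k : coef) (X : choiceType).
Local Notation R := (coef_ring k).
Local Notation m := (maug k X).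
Local Notation T := (tpow m).

Definition iota1 (q : m) : T 1 := tens [tuple q].
(* The inverse of the isomorphism iota1 : m -> T^1. *)
Definition deg1 (u : T 1) : m := tlift (fun t => thead t) u.

Definition tens2 (q r : m) : T 2 := tens [tuple q; r].
Definition tlift2 (W : lmodType R) (f : m -> m -> W) : T 2 -> W :=
  tlift (fun t => f (tnth t ord0) (tnth t ord_max)).

Definition tcup i j (u : T i) (v : T j) : T (i + j) :=
  tlift (fun s => tlift (fun t => tens (cat_tuple s t)) v) u.

Definition tcup1 (u v : T 1) : T 1 := iota1 (maug_mul (deg1 u) (deg1 v)).

Definition tcup21 (w : T 2) (u : T 1) : T 2 :=
  tlift2 (fun a b => tens2 (maug_mul a (deg1 u)) b + tens2 a (maug_mul b (deg1 u))) w.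

Definition tcirc (v w : T 2) : T 2 :=
  tlift2 (fun a1 a2 =>
    tlift2 (fun b1 b2 => tens2 (maug_mul a1 b1) (maug_mul a2 b2)) w) v.

Definition tensor_alg : cupone_alg R :=
  @CupOneAlg R T (tens [tuple]) tcup tcup1 tcup21 tcirc.

Variable tau : X -> T 2.

Definition is_d_tau (d : degree1_map tensor_alg) : Prop :=
  [/\ forall n, linear (@d n),
      forall x, d _ (iota1 (maug_var k x)) = tau x,
      graded_leibniz d
    & forall a b, cup1_d_formula d a b].

(* Definite description of the d satisfying is_d_tau; the default 0 is never used,
   since such a d exists and is unique. *)
Definition d_tau : degree1_map tensor_alg :=
  if pselect (exists d, is_d_tau d) is left ex then sval (cid ex) else fun _ _ => 0.

Definition mu (a a' : X -> R) : X -> R := fun x =>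
  a x + a' x -
    tlift2 (fun q r => IntR_eval (val q) a * IntR_eval (val r) a' : R^o) (tau x).

Definition admissible : Prop := associative mu.

Definition bar_alg : cupone_alg R := bar_cochains R (X -> R).

Definition d_bar : degree1_map bar_alg := bar_d mu.

Definition extends_eval (psi : forall n, tensor_alg n -> bar_alg n) : Prop :=
  forall (q : m) (s : simplex (X -> R) 1),
    psi 1 (iota1 q) s = IntR_eval (val q) (s ord0).

End TensorAlgebra.

(* Main.v *)
From HB Require Import structures.
Require Import Defs.
From mathcomp Require Import all_boot all_order all_algebra.
From mathcomp Require Import finmap zify ring.
From mathcomp Require Import boolp classical_sets functions.
From mathcomp.multinomials Require Import monalg.

Set Implicit Arguments.
Unset Strict Implicit.
Unset Printing Implicit Defensive.

Import GRing.Theory Num.Theory.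
Local Open Scope ring_scope.
Local Open Scope quotient_scope.

(** Write M = R^X.  A tensor q_1 (x) .. (x) q_n of elements of the augmentation ideal m is
    realized by psi as the function (a_1, .., a_n) |-> q_1(a_1) .. q_n(a_n) on M^n.  Newton
    interpolation at non-negative integer points, whose basis consists of products of
    binomial coefficients, writes every q in a given finite list as the sum of the terms
    q(a_i) e_i, with fixed points a_i and fixed e_i; by multilinearity the same holds for
    finite lists of tensors.  Hence psi is injective and its image is pure: if c f lies in
    it for some c <> 0, then so does f.
    The tensors whose realization has its coboundary in the image of psi contain the
    variables, by definition of mu_tau, and are closed under cup by the Leibniz rule, under
    cup_1 by the cup_1-d formula, and under division by purity; these operations generate
    all tensors from the variables.  So the image of psi is a subcomplex of the bar cochains,
    d_tau is the coboundary transported along psi, and every identity for it, d_tau^2 = 0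
    included, is pulled back from the bar complex. *)

Definition is_bilinear (R : pzRingType) (U V W : lmodType R) (f : U -> V -> W) : Prop :=
  (forall v, linear (f^~ v)) /\ (forall u, linear (f u)).

Lemma bilinear_sum (R : comNzRingType) (U V W : lmodType R) (f : U -> V -> W)
    (I J : finType) (c : I -> R) (u : I -> U) (d : J -> R) (v : J -> V) :
    is_bilinear f ->
  f (\sum_i c i *: u i) (\sum_j d j *: v j)
    = \sum_(ij : I * J) (c ij.1 * d ij.2) *: f (u ij.1) (v ij.2).
Proof.
move=> [f_linl f_linr].
pose fl v : {linear U -> W} := HB.pack (f^~ v) (GRing.isLinear.Build R U W _ _ (f_linl v)).
pose fr u : {linear V -> W} := HB.pack (f u) (GRing.isLinear.Build R V W _ _ (f_linr u)).
rewrite -(pair_bigA _ (fun i j => (c i * d j) *: f (u i) (v j))) /=.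
set y := (X in f _ X); transitivity (\sum_i c i *: f (u i) y).
  by rewrite -[LHS]/(fl y _) linear_sum; apply: eq_bigr => i _; rewrite linearZ.
apply: eq_bigr => i _; rewrite -[f _ y]/(fr _ y) linear_sum scaler_sumr.
by apply: eq_bigr => j _; rewrite linearZ scalerA.
Qed.

Section Characters.
Variables (R : comNzRingType) (V : lmodType R) (e : V) (mul : V -> V -> V).
Variables (I : Type) (chi : I -> {scalar V}).

Definition separating : Prop := forall u v, (forall i, chi i u = chi i v) -> u = v.

Lemma separating_scaler_inj c :
  separating -> GRing.lreg c -> injective (fun v : V => c *: v).
Proof.
move=> chi_sep c_reg u v uv; apply: chi_sep => i; apply: c_reg.
by rewrite -!linearZ_LR uv.
Qed.

Definition characters : Prop :=
  (forall i u v, chi i (mul u v) = chi i u * chi i v) /\ (forall i, chi i e = 1).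

Lemma comm_algebra_of_characters : separating -> characters -> comm_algebra e mul.
Proof.
move=> chi_sep [chiM chi1]; split.
- by move=> u v; apply: chi_sep => i; rewrite !chiM mulrC.
- by move=> u v w; apply: chi_sep => i; rewrite !chiM mulrA.
- by move=> u; apply: chi_sep => i; rewrite chiM chi1 mul1r.
- move=> w r u v; apply: chi_sep => i.
  by rewrite chiM !scalarP !chiM mulrDr mulrCA.
Qed.

End Characters.

(** * The bar complex *)

Section Span.
Variables (R : pzRingType) (V : lmodType R).
Implicit Types (G : V -> Prop) (v : V).

Lemma mem_lspan G v : G v -> v \in lspan G.
Proof.
move=> Gv; apply/asboolP; exists [:: (1, v)]; rewrite big_seq1 scale1r.
by split=> // rg; rewrite inE => /eqP->.
Qed.

Lemma lspan_ind G (P : V -> Prop) :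
    P 0 -> (forall r g v, G g -> v \in lspan G -> P v -> P (r *: g + v)) ->
  forall v, v \in lspan G -> P v.
Proof.
move=> P0 PD _ /asboolP[s [Gs ->]].
suff [] : (\sum_(rg <- s) rg.1 *: rg.2 \in lspan G) /\ P (\sum_(rg <- s) rg.1 *: rg.2) by [].
elim: s Gs => [|rg s IHs] Gs; first by rewrite big_nil; split; [exact: rpred0|].
have Grg : G rg.2 by apply: Gs; rewrite mem_head.
have [|sG Ps] := IHs; first by move=> rg' s_rg'; apply: Gs; rewrite inE s_rg' orbT.
rewrite big_cons; split; last exact: PD.
by apply: rpredD => //; apply/rpredZ/mem_lspan.
Qed.

End Span.

Lemma lspan_map (R : pzRingType) (V W : lmodType R) (f : {linear V -> W})
    (G : V -> Prop) (H : W -> Prop) :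
  (forall g, G g -> H (f g)) -> forall v, v \in lspan G -> f v \in lspan H.
Proof.
move=> GH; apply: lspan_ind => [|r g v /GH Hfg _ Hfv]; first by rewrite linear0 rpred0.
by rewrite linearP; apply: rpredD => //; apply/rpredZ/mem_lspan.
Qed.

Section Decomposables.
Variables (R : comNzRingType) (A : cupone_alg R).
Local Notation D2 := (@decomp R A).

Lemma cup_decomp (a b : A 1) : cup a b \in D2.
Proof. by apply: mem_lspan; exists a, b. Qed.

Lemma circ_decomp :
    (forall r (u v w : A 2), u \in D2 -> v \in D2 -> w \in D2 ->
       circ (r *: u + v) w = r *: circ u w + circ v w) ->
    (forall r (u v w : A 2), u \in D2 -> v \in D2 -> w \in D2 ->
       circ w (r *: u + v) = r *: circ w u + circ w v) ->
    (forall u v w z : A 1,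
       circ (cup u v) (cup w z) = cup (cup1 u w) (cup1 v z) :> A 2) ->
  forall v w : A 2, v \in D2 -> w \in D2 -> circ v w \in D2.
Proof.
move=> circDl circDr circ_cup.
have D0 : 0 \in D2 by apply: rpred0.
have circ0l w : w \in D2 -> circ 0 w = 0.
  by move=> Dw; rewrite -[0 in LHS](addNr 0) -scaleN1r circDl // scaleN1r addNr.
have circ0r w : w \in D2 -> circ w 0 = 0.
  by move=> Dw; rewrite -[0 in LHS](addNr 0) -scaleN1r circDr // scaleN1r addNr.
move=> v w; move: v; apply: lspan_ind => [Dw|r _ v [a [b ->]] Dv IHv Dw].
  by rewrite circ0l.
rewrite circDl ?cup_decomp //; apply: rpredD; last exact: IHv.
apply: rpredZ; move: w Dw {IHv}; apply: lspan_ind => [|s _ w [c [e ->]] Dw IHw].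
  by rewrite circ0r ?cup_decomp.
rewrite circDr ?cup_decomp //; apply: rpredD => //; apply: rpredZ.
by rewrite circ_cup cup_decomp.
Qed.

End Decomposables.

Section Cochains.
Variables (R : comNzRingType) (M : Type).
Local Notation C := (cochain R M).

Lemma cochain0 n s : (0 : C n) s = 0. Proof. by []. Qed.
Lemma cochainD n (f g : C n) s : (f + g) s = f s + g s. Proof. by []. Qed.
Lemma cochainN n (f : C n) s : (- f) s = - f s. Proof. by []. Qed.
Lemma cochainZ n r (f : C n) s : (r *: f) s = r * f s. Proof. by []. Qed.

Definition cochainE := (cochain0, cochainD, cochainN, cochainZ).

Lemma cochain_cup11E (f g : C 1) (s : simplex M 2) :
  cochain_cup f g s = f (fun=> s ord0) * g (fun=> s ord_max).
Proof.
rewrite /cochain_cup; congr (f _ * g _); apply: funext => i; rewrite ord1;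
  by congr s; apply: val_inj.
Qed.

Definition cochain_at n (s : simplex M n) (f : C n) : R := f s.

Lemma cochain_at_scalar n (s : simplex M n) : scalar (cochain_at s).
Proof. by []. Qed.

HB.instance Definition _ n (s : simplex M n) :=
  GRing.isLinear.Build R (C n) R _ (cochain_at s) (cochain_at_scalar s).

Definition bar_char (i : option (simplex M 1)) (x : unitized (bar_cochains R M)) : R :=
  if i is Some s then x.1 + x.2 s else x.1.

Lemma bar_char_scalar i : scalar (bar_char i).
Proof.
case: i => [s|//] r x y; rewrite /bar_char /= !cochainE.
by rewrite mulrDr -!addrA; congr (_ + _); rewrite addrCA.
Qed.

HB.instance Definition _ i :=
  GRing.isLinear.Build R (unitized (bar_cochains R M)) R _ (bar_char i) (bar_char_scalar i).

End Cochains.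

Section BarComplex.
Variables (R : comNzRingType) (M : Type) (op : M -> M -> M) (x0 : M).

Local Notation C := (cochain R M).
Local Notation A := (bar_cochains R M).

Lemma bar_d_linear n : linear (@bar_d R M op n).
Proof.
move=> r f g; apply: funext => s; rewrite !cochainE /bar_d mulr_sumr -big_split.
by apply: eq_bigr => i _; rewrite !cochainE /= mulrDr mulrCA.
Qed.

HB.instance Definition _ n :=
  GRing.isLinear.Build R (C n) (C n.+1) _ (@bar_d R M op n) (@bar_d_linear n).

(* Simplices are handled as restrictions of sequences indexed by [nat], which
   removes all ordinal arithmetic from the face identities. *)
Definition restr n (s : nat -> M) : simplex M n := fun i => s i.
Arguments restr n s i : clear implicits.

Definition seq_face (i : nat) (s : nat -> M) : nat -> M := fun l =>
  if (l.+1 < i)%N then s l else if l.+1 == i then op (s l) (s l.+1) else s l.+1.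

Definition seq_shift (i : nat) (s : nat -> M) : nat -> M := fun l => s (i + l)%N.

Lemma restr_surj n (s : simplex M n) : exists s', s = restr n s'.
Proof.
exists (fun l => if insub l is Some i then s i else x0).
by apply: funext => i; rewrite /restr valK.
Qed.

Lemma eq_cochain_restr n (f g : C n) : (forall s, f (restr n s) = g (restr n s)) -> f = g.
Proof. by move=> fg; apply: funext => s; have [s' ->] := restr_surj s. Qed.

Lemma bar_d_restr n (f : C n) s :
  bar_d op f (restr n.+1 s)
    = \sum_(0 <= i < n.+2) (-1) ^+ i * f (restr n (seq_face i s)).
Proof. by rewrite big_mkord. Qed.

Lemma cochain_cup_restr i j (f : C i) (g : C j) s :
  cochain_cup f g (restr (i + j) s) = f (restr i s) * g (restr j (seq_shift i s)).
Proof. by []. Qed.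

Lemma gcast_restr m n (e : m = n) (f : C m) s :
  gcast (A := A) e f (restr n s) = f (restr m s).
Proof. by case: n / e. Qed.

Lemma restr_face_gt n i s : (n < i)%N -> restr n (seq_face i s) = restr n s.
Proof.
move=> lt_ni; apply: funext => l; rewrite /restr /seq_face ifT //.
exact: leq_ltn_trans (ltn_ord l) lt_ni.
Qed.

Lemma seq_face0 s : seq_face 0 s = seq_shift 1 s.
Proof. by []. Qed.

Lemma cochain_cup_front_face i j l (f : C i) (g : C j) s : (l <= i)%N ->
  cochain_cup f g (restr (i + j) (seq_face l s))
    = f (restr i (seq_face l s)) * g (restr j (seq_shift i.+1 s)).
Proof.
move=> le_li; rewrite cochain_cup_restr; congr (_ * g _); apply: funext => q.
by rewrite /restr /seq_shift /seq_face !ifF //; lia.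
Qed.

Lemma cochain_cup_back_face i j l (f : C i) (g : C j) s :
  cochain_cup f g (restr (i + j) (seq_face (i + l.+1) s))
    = f (restr i s) * g (restr j (seq_face l.+1 (seq_shift i s))).
Proof.
rewrite cochain_cup_restr restr_face_gt; last by lia.
congr (_ * g _); apply: funext => q; rewrite /restr /seq_shift /seq_face.
by rewrite -addnS ltn_add2l eqn_add2l addnS.
Qed.

(* The last face of the front and the first face of the back cancel. *)
Lemma bar_d_leibniz : graded_leibniz (A := A) (@bar_d R M op).
Proof.
move=> i j f g; apply: eq_cochain_restr => s.
rewrite !cochainE gcast_restr.
rewrite [RHS](_ : _ = bar_d op f (restr i.+1 s) * g (restr j (seq_shift i.+1 s))
  + (-1) ^+ i * (f (restr i s) * bar_d op g (restr j.+1 (seq_shift i s)))) //.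
rewrite !bar_d_restr [in RHS]big_nat_recr //= restr_face_gt //.
rewrite [X in _ + _ * (_ * X)]big_nat_recl //= seq_face0 expr0 mul1r.
rewrite (_ : seq_shift 1 (seq_shift i s) = seq_shift i.+1 s); last first.
  by apply: funext => l; rewrite /seq_shift addnA addn1.
rewrite (@big_cat_nat _ _ _ i.+1) //=; last by lia.
rewrite (_ : \sum_(0 <= l < i.+1) _ = (\sum_(0 <= l < i.+1)
    (-1) ^+ l * f (restr i (seq_face l s))) * g (restr j (seq_shift i.+1 s))); last first.
  rewrite mulr_suml; apply: congr_big_nat => // l /andP[_ le_li].
  by rewrite -mulrA -cochain_cup_front_face.
rewrite (_ : \sum_(i.+1 <= l < _) _ = (-1) ^+ i * (f (restr i s) *
    \sum_(0 <= l < j.+1) (-1) ^+ l.+1 * g (restr j (seq_face l.+1 (seq_shift i s)))));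
  last first.
  rewrite -{1}[i.+1]add0n -addSn -addnS big_addn addKn !mulr_sumr.
  apply: congr_big_nat => // l _; rewrite addnC addSnnS exprD -mulrA; congr (_ * _).
  by rewrite [X in _ * X]cochain_cup_back_face mulrCA.
by rewrite exprS; ring.
Qed.

Lemma alternating_double_sum n (G : nat -> nat -> R) :
    (forall i j, (i <= j)%N -> G i j = G j.+1 i) ->
  \sum_(0 <= i < n.+1) (-1) ^+ i * (\sum_(0 <= j < n) (-1) ^+ j * G i j) = 0.
Proof.
move=> GE; elim: n => [|n IHn]; first by rewrite big_nat1 big_geq ?mulr0.
rewrite big_nat_recr //=.
under eq_bigr => i _ do rewrite big_nat_recr //= mulrDr.
rewrite big_split /= IHn add0r mulr_sumr -big_split big_nat big1 //= => i lt_in.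
by rewrite GE // exprS; ring.
Qed.

Lemma bar_d_deg0 (f : C 0) : bar_d op f = 0.
Proof.
apply: eq_cochain_restr => s; rewrite bar_d_restr !big_nat_recr //= big_geq // add0r.
rewrite expr0 expr1 mulN1r mul1r (_ : restr 0 _ = restr 0 (seq_face 1 s)) ?subrr //.
by apply: funext => -[].
Qed.

Lemma bar_d_deg1 (f : C 1) (s : simplex M 2) :
  bar_d op f s
    = f (fun=> s ord_max) - f (fun=> op (s ord0) (s ord_max)) + f (fun=> s ord0).
Proof.
have restr1 t : restr 1 t = fun=> t 0 by apply: funext => i; rewrite /restr ord1.
have [s' ->] := restr_surj s; rewrite bar_d_restr !big_nat_recr //= big_geq // add0r.
by rewrite !restr1 /seq_face /= expr0 expr1 sqrrN expr1n !mul1r mulN1r.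
Qed.

Lemma bar_cup1_d (f g : A 1) : cup1_d_formula (A := A) (@bar_d R M op) f g.
Proof.
apply: funext => s; rewrite !cochainE /cup /= !cochain_cup11E bar_d_deg1.
rewrite /cochain_cup21 /cochain_circ /cochain_cup1 !bar_d_deg1; ring.
Qed.

Section Associative.
Hypothesis opA : associative op.

Lemma seq_face_face i j s : (i <= j)%N ->
  seq_face j (seq_face i s) = seq_face i (seq_face j.+1 s).
Proof.
move=> le_ij; apply: funext => l; rewrite /seq_face.
by repeat (case: ifP => ?); try lia; rewrite ?opA.
Qed.

Lemma bar_dd n (f : C n) : bar_d op (bar_d op f) = 0.
Proof.
apply: eq_cochain_restr => s; rewrite bar_d_restr.
under eq_bigr => i _ do rewrite bar_d_restr.
apply: (@alternating_double_sum n.+2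
  (fun i j => f (restr n (seq_face j (seq_face i s))))).
by move=> i j le_ij; rewrite seq_face_face.
Qed.

End Associative.

Lemma cochain_cup_bilinear i j :
  is_bilinear (fun (f : C i) (g : C j) => cochain_cup f g : C (i + j)).
Proof.
by split=> [g r f f'|f r g g']; apply: funext => s; rewrite /cochain_cup !cochainE; ring.
Qed.

Lemma cochain_circ_bilinear : is_bilinear (@cochain_circ R M : C 2 -> C 2 -> C 2).
Proof.
by split=> [w r f g|w r f g]; apply: funext => s; rewrite /cochain_circ !cochainE; ring.
Qed.

Lemma bar_graded_algebra : is_graded_algebra A.
Proof.
split.
- by move=> i j; have [] := cochain_cup_bilinear i j.
- by move=> i j; have [] := cochain_cup_bilinear i j.
- move=> i j l f g h; apply: eq_cochain_restr => s; rewrite gcast_restr /=.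
  rewrite !cochain_cup_restr mulrA; congr (_ * h _).
  by apply: funext => q; rewrite /restr /seq_shift addnA.
- by move=> i f; apply: eq_cochain_restr => s; rewrite /= cochain_cup_restr mul1r.
- by move=> i f; apply: eq_cochain_restr => s; rewrite gcast_restr /= cochain_cup_restr mulr1.
Qed.

Lemma bar_char_separating : separating (@bar_char R M).
Proof.
move=> [r f] [r' g] fg; have rE : r = r' := fg None; congr pair => //.
by apply: funext => s; have := fg (Some s); rewrite /= rE => /addrI.
Qed.

Lemma bar_char_characters : characters (uone A) (@umul R A) (@bar_char R M).
Proof.
split=> [] [s|] //; last by rewrite /bar_char /= addr0.
move=> [a f] [b g]; rewrite /bar_char /= !cochainE /cochain_cup1 mulrDl !mulrDr -!addrA.
by congr (_ + (_ + (_ + _))); exact: mulrC.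
Qed.

Lemma cochain_cup_deg0C (c : C 0) (f : C 1) : cochain_cup f c = cochain_cup c f :> C 1.
Proof.
apply: funext => s; rewrite /cochain_cup mulrC.
by congr (c _ * f _); apply: funext => i; [case: i|congr s; apply: val_inj].
Qed.

Lemma bar_is_cupone_dga : associative op -> is_cupone_dga (A := A) (@bar_d R M op).
Proof.
move=> opA.
have [circ_linl circ_linr] := cochain_circ_bilinear.
have circ_cup (u v w z : C 1) : cochain_circ (cochain_cup u v) (cochain_cup w z)
    = cochain_cup (cochain_cup1 u w) (cochain_cup1 v z) :> C 2.
  by apply: funext => s; rewrite /cochain_circ !cochain_cup11E /cochain_cup1; ring.
split.
- split; [exact: bar_graded_algebra|exact: bar_d_linear|exact: bar_dd|exact: bar_d_leibniz].
- split=> [g r f f'|f r g g'|r v w f _ _|w _ r f g]; apply: funext => s;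
    by rewrite !cochainE /= /cochain_cup1 /cochain_cup21 !cochainE; ring.
- split=> [v w|r u v w _ _ _|r u v w _ _ _]; [|exact: circ_linl|exact: circ_linr].
  by apply: circ_decomp => *; [exact: circ_linl|exact: circ_linr|exact: circ_cup].
- split.
  + exact: comm_algebra_of_characters bar_char_separating bar_char_characters.
  + move=> f g h; apply: funext => s; rewrite !cochainE /= !cochain_cup11E.
    by rewrite /cochain_cup21 /cochain_cup1 !cochain_cup11E; ring.
  + exact: circ_cup.
  + move=> f c; rewrite [X in cup1 _ X]bar_d_deg0 [cup f c]cochain_cup_deg0C subrr.
    by apply: funext => s; rewrite /= /cochain_cup1 mulr0.
  + by move=> f g _ _; apply: bar_cup1_d.
Qed.

End BarComplex.

(** * Binomial algebras *)

Lemma natr_ffact (A : pzRingType) j k : (j ^_ k)%:R = \prod_(i < k) (j%:R - i%:R) :> A.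
Proof.
elim: k => [|k IHk]; first by rewrite big_ord0.
rewrite big_ord_recr -IHk ffactnSr natrM /=.
have [le_kj|lt_jk] := leqP k j; first by rewrite natrB.
by rewrite ffact_small ?mul0r.
Qed.

Lemma int_fact_dvd_falling (z : int) n : exists w : int, w *+ n`! = \prod_(i < n) (z - i%:R).
Proof.
case: z => m.
  exists ('C(m, n))%:Z; rewrite -mulr_natr natz -PoszM bin_ffact -natz natr_ffact.
  by apply: eq_bigr => i _; rewrite !natz.
exists ((-1) ^+ n * ('C(m + n, n))%:Z).
rewrite -mulr_natr natz -mulrA -PoszM bin_ffact.
elim: n => [|n IHn]; first by rewrite big_ord0 addn0.
rewrite big_ord_recr -IHn addnS ffactSS /= PoszM NegzE exprS natz.
by rewrite (_ : (m + n).+1 = (m.+1 + n)%N) // PoszD; ring.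
Qed.

Lemma prime_dvd_fact p n : prime p -> (p %| n`!)%N -> (p <= n)%N.
Proof.
move=> p_pr; elim: n => [|n IHn]; first by rewrite dvdn1 => /eqP p1; rewrite p1 in p_pr.
rewrite factS Euclid_dvdM // => /orP[/dvdn_leq-> //|/IHn]; exact: leqW.
Qed.

Lemma Fp_fact_neq0 p n : prime p -> (n < p)%N -> n`!%:R != 0 :> 'F_p.
Proof.
move=> p_pr lt_np; rewrite -(dvdn_pcharf (pchar_Fp p_pr)).
by apply/negP => /(prime_dvd_fact p_pr); rewrite leqNgt lt_np.
Qed.

Section Coefficients.
Variable k : coef.
Local Notation R := (coef_ring k).

Lemma coef_lreg (c : R) : c != 0 -> GRing.lreg c.
Proof.
by case: k c => [|p p_pr] c c0 x y; [apply: (@mulfI int)|apply: (@mulfI 'F_p)].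
Qed.

Lemma coef_fact_neq0 n : zeta_range k n -> n`!%:R != 0 :> R.
Proof.
rewrite /zeta_range; case: k => [|p p_pr] /andP[_ n_p]; last exact: Fp_fact_neq0.
by rewrite (pnatr_eq0 int) -lt0n fact_gt0.
Qed.

Lemma coef_fact_dvd_falling n (r : R) :
  zeta_range k n -> exists w, w *+ n`! = \prod_(i < n) (r - i%:R).
Proof.
move=> /coef_fact_neq0; case: k r => [|p p_pr] r n0; first exact: int_fact_dvd_falling.
exists ((n`!%:R : 'F_p)^-1 * \prod_(i < n) (r - i%:R)).
by rewrite -mulr_natl mulrA [X in X * _](mulfV (F := 'F_p) n0) mul1r.
Qed.

End Coefficients.

Lemma coef_expp p (p_pr : prime p) (r : coef_ring (CoefF p_pr)) : r ^+ p = r.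
Proof.
have := pFrobenius_aut_nat (pchar_Fp p_pr) r.
by rewrite pFrobenius_autE natr_Zp.
Qed.

Section PureImage.
Variables (R : comNzRingType) (V : lmodType R) (I : Type) (chi : I -> {scalar V}).

Definition pure_image : Prop := forall c (f : I -> R) v,
  GRing.lreg c -> (forall i, chi i v = c * f i) -> exists w, forall i, chi i w = f i.

Lemma full_pure_image : (forall f, exists v, forall i, chi i v = f i) -> pure_image.
Proof. by move=> chi_full c f _ _ _. Qed.

End PureImage.

Section BinomialAlgebra.
Variables (k : coef) (V : lmodType (coef_ring k)) (e : V) (mul : V -> V -> V).
Variables (I : Type) (chi : I -> {scalar V}).
Hypotheses (chi_sep : separating chi) (chi_char : characters e mul chi).

Lemma character_falling i a n :
  chi i (falling e mul a n) = \prod_(j < n) (chi i a - j%:R).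
Proof.
have [chiM chi1] := chi_char; rewrite /falling (big_morph (chi i) (chiM i) (chi1 i)).
by apply: eq_bigr => j _; rewrite linearB linearMn chi1.
Qed.

Lemma mulrn_fact_inj n : zeta_range k n -> injective (fun v : V => v *+ n`!).
Proof.
move=> /coef_fact_neq0/coef_lreg n_reg u v; rewrite -!scaler_nat.
exact: (separating_scaler_inj chi_sep n_reg).
Qed.

Hypothesis chi_pure : pure_image chi.

Lemma falling_divisible a n : zeta_range k n -> exists z, z *+ n`! = falling e mul a n.
Proof.
move=> n_k; have [w wE] := choice (fun r => coef_fact_dvd_falling r n_k).
have n_reg : GRing.lreg (n`!%:R : coef_ring k) by apply/coef_lreg/coef_fact_neq0.
have [i|z zE] := chi_pure (v := falling e mul a n) (f := fun i => w (chi i a)) n_reg.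
  by rewrite mulr_natl wE character_falling.
by exists z; apply: chi_sep => i; rewrite linearMn zE wE character_falling.
Qed.

Lemma binomial_algebra_of_characters : binomial_algebra e mul.
Proof.
split; first exact: comm_algebra_of_characters chi_sep chi_char.
have V_div := falling_divisible; have [chiM chi1] := chi_char.
case: k V e mul chi chi_sep chiM chi1 V_div => [|p p_pr] V' e' mul' ch ch_sep chM ch1 V_div.
  split=> [a n n_gt0 an0|a n n_gt0]; last by apply: V_div; rewrite /zeta_range n_gt0.
  apply: ch_sep => i; have := congr1 (ch i) an0; rewrite linearMn !linear0.
  by move=> /eqP; rewrite (mulrn_eq0 (ch i a : int)) eqn0Ngt n_gt0 => /eqP.
move=> a; apply: ch_sep => i.
by rewrite (big_morph (ch i) (chM i) (ch1 i)) prodr_const card_ord coef_expp.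
Qed.

End BinomialAlgebra.

Section Zeta.
Variable k : coef.
Implicit Types V W : lmodType (coef_ring k).

Lemma zetaP V (e : V) mul n a : (exists z, z *+ n`! = falling e mul a n) ->
  zeta e mul n a *+ n`! = falling e mul a n.
Proof.
by case=> z zE; apply: (@xgetPex _ 0 [set z | z *+ n`! = falling e mul a n]%classic); exists z.
Qed.

Lemma zeta_eq V (e : V) mul n a z : injective (fun v : V => v *+ n`!) ->
  z *+ n`! = falling e mul a n -> zeta e mul n a = z.
Proof. by move=> n_inj zE; apply: n_inj; rewrite zetaP //; exists z. Qed.

Lemma zeta_morph V W (e : V) mul e' mul' (f : {linear V -> W}) n a :
    {morph f : u v / mul u v >-> mul' u v} -> f e = e' ->
    (exists z, z *+ n`! = falling e mul a n) -> injective (fun w : W => w *+ n`!) ->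
  f (zeta e mul n a) = zeta e' mul' n (f a).
Proof.
move=> fM f1 a_div n_inj; apply/esym/zeta_eq; first exact: n_inj.
rewrite -linearMn zetaP // /falling (big_morph f fM f1); apply: eq_bigr => i _.
by rewrite linearB linearMn f1.
Qed.

End Zeta.

(** * Integer-valued polynomials *)

Section Interpolation.
Variables (R : comNzRingType) (V : lmodType R) (P : Type) (ev : P -> {scalar V}).

Definition interpolable : Prop := forall s : seq V,
  exists (I : finType) (a : I -> P) (e : I -> V),
    {in s, forall v, v = \sum_i ev (a i) v *: e i}.

Lemma interpolable_separating : interpolable -> separating ev.
Proof.
move=> ev_interp u v uv; have [I [a [e eE]]] := ev_interp [:: u; v].
have v_in : v \in [:: u; v] by rewrite !inE eqxx orbT.
rewrite (eE u (mem_head _ _)) (eE v v_in).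
by apply: eq_bigr => i _; rewrite uv.
Qed.

Lemma interpolable_pure : interpolable -> pure_image ev.
Proof.
move=> ev_interp c f v c_reg vE; have [I [a [e eE]]] := ev_interp [:: v].
exists (\sum_i f (a i) *: e i) => p; apply: c_reg; rewrite -vE (eE v (mem_head _ _)).
rewrite -linearZ_LR scaler_sumr; congr (ev p _); apply: eq_bigr => i _.
by rewrite vE scalerA.
Qed.

End Interpolation.

Section UnivariateInterpolation.

Definition bin_poly (k : nat) : {poly rat} :=
  (k`!%:R)^-1 *: \prod_(i < k) ('X - i%:R%:P).

Definition newton_coef (k b : nat) : int := (('X - 1) ^+ k : {poly int})`_b.

Definition lagrange_poly (N b : nat) : {poly rat} :=
  \sum_(k < N) (newton_coef k b)%:~R *: bin_poly k.

Lemma newton_coef_gt k b : (k < b)%N -> newton_coef k b = 0.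
Proof. by move=> lt_kb; rewrite /newton_coef nth_default // size_exp_XsubC. Qed.

(* Expanding 'X^j = (1 + ('X - 1))^j inverts the Pascal matrix. *)
Lemma sum_newton_coef_bin b j :
  \sum_(k < j.+1) newton_coef k b * 'C(j, k)%:R = (b == j)%:R.
Proof.
have := exprDn (1 : {poly int}) ('X - 1) j; rewrite addrCA subrr addr0.
move=> /(congr1 (coefp b)); rewrite /= coefXn coef_sum => ->.
by apply: eq_bigr => k _; rewrite expr1n mul1r coefMn mulr_natr.
Qed.

Lemma horner_bin_poly_nat k j : (bin_poly k).[j%:R] = 'C(j, k)%:R.
Proof.
rewrite /bin_poly hornerZ horner_prod.
under eq_bigr => i _ do rewrite !hornerE.
by rewrite -natr_ffact -bin_ffact natrM mulrC mulfK // pnatr_eq0 -lt0n fact_gt0.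
Qed.

Lemma size_bin_poly k : (size (bin_poly k) <= k.+1)%N.
Proof.
apply: leq_trans (size_scale_leq _ _) _.
by rewrite size_prod_XsubC /index_enum -enumT size_enum_ord.
Qed.

Lemma size_lagrange_poly N b : (size (lagrange_poly N b) <= N)%N.
Proof.
apply: leq_trans (size_sum _ _ _) _; apply/bigmax_leqP => k _.
apply: leq_trans (size_scale_leq _ _) _.
exact: leq_trans (size_bin_poly _) (ltn_ord k).
Qed.

Lemma horner_lagrange_poly_nat N b j : (j < N)%N ->
  (lagrange_poly N b).[j%:R] = (b == j)%:R.
Proof.
move=> lt_jN; rewrite /lagrange_poly horner_sum.
transitivity ((\sum_(k < j.+1) newton_coef k b * 'C(j, k)%:R)%:~R : rat); last first.
  by rewrite sum_newton_coef_bin rmorph_nat.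
rewrite rmorph_sum (big_ord_widen N (fun k => (newton_coef k b * 'C(j, k)%:R)%:~R)) //.
rewrite [RHS]big_mkcond; apply: eq_bigr => k _.
rewrite hornerZ horner_bin_poly_nat rmorphM /= rmorph_nat.
by case: ltnP => // lt_jk; rewrite bin_small // mulr0.
Qed.

Lemma lagrange_poly_interp N (p : {poly rat}) : (size p <= N)%N ->
  p = \sum_(b < N) p.[b%:R] *: lagrange_poly N b.
Proof.
move=> size_p; apply/eqP; rewrite -subr_eq0; apply/eqP.
apply: (@roots_geq_poly_eq0 _ _ [seq j%:R | j <- iota 0 N]).
- apply/allP => y /mapP[j]; rewrite mem_iota add0n => /andP[_ lt_jN] ->.
  rewrite /root hornerD hornerN horner_sum subr_eq0 (bigD1 (Ordinal lt_jN)) //= big1.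
    by rewrite hornerZ horner_lagrange_poly_nat // eqxx mulr1 addr0.
  move=> b /negPf ne_bj; rewrite hornerZ horner_lagrange_poly_nat //.
  by rewrite -[_ == _]/(b == Ordinal lt_jN) ne_bj mulr0.
- by rewrite map_inj_uniq ?iota_uniq // => i j /eqP; rewrite eqr_nat => /eqP.
rewrite size_map size_iota (leq_trans (size_polyD _ _)) // geq_max size_p size_polyN.
apply: leq_trans (size_sum _ _ _) _; apply/bigmax_leqP => b _.
exact: leq_trans (size_scale_leq _ _) (size_lagrange_poly _ _).
Qed.

End UnivariateInterpolation.

Lemma malgUZ (R : nzRingType) (K : choiceType) (c : R) (m : K) :
  << c *g m >> = c *: << m >> :> {malg R[K]}.
Proof. by apply/malgP => m'; rewrite mcoeffZ !mcoeffU mulrnAr mulr1. Qed.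

Section Monomials.
Variable X : choiceType.
Implicit Types (m : {cmonom X}) (D : {fset X}).

Lemma cmonom_prod m D : (finsupp m `<=` D)%fset ->
  m = \big[mmul/mone]_(x <- D) \big[mmul/mone]_(i < m x) ucm x.
Proof.
move=> mD; apply/eqP/cmP => y.
have eval_prod (I : Type) (s : seq I) (F : I -> {cmonom X}) :
    (\big[mmul/mone]_(i <- s) F i) y = (\sum_(i <- s) F i y)%N.
  exact: (big_morph (fun m : {cmonom X} => m y : nat) (cmM y) (cm1 y)).
rewrite eval_prod; under eq_bigr => x _ do rewrite eval_prod sum_nat_const card_ord cmU.
have [yD|yD] := boolP (y \in D).
  rewrite (big_fsetD1 y) //= eqxx muln1 big1_seq ?addn0 // => x /andP[_].
  by rewrite !inE => /andP[/negPf-> _]; rewrite muln0.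
rewrite big1_seq => [|x /andP[_ xD]].
  by apply/eqP; rewrite cmE_eq0; apply: contra yD; apply: (fsubsetP mD).
by case: eqP => [xy|_]; rewrite ?muln0 //; rewrite -xy xD in yD.
Qed.

Lemma malg_cmonom_prod (R : comNzRingType) m D : (finsupp m `<=` D)%fset ->
  << m >> = \prod_(x <- D) << ucm x >> ^+ m x :> {malg R[{cmonom X}]}.
Proof.
move=> mD; have malgU_prod (I : Type) (s : seq I) (F : I -> {cmonom X}) :
    << \big[mmul/mone]_(i <- s) F i >> = \prod_(i <- s) << F i >> :> {malg R[{cmonom X}]}.
  apply: (big_morph (fun m => << m >>)) => // m1 m2.
  by rewrite [RHS]fgmulUU mulr1.
rewrite {1}(cmonom_prod mD) malgU_prod; apply: eq_bigr => x _.
by rewrite malgU_prod prodr_const card_ord.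
Qed.

End Monomials.

Section IntegerValued.
Variable X : choiceType.
Implicit Types (q : IntZ X) (a : X -> int) (x : X).

Definition IntZ_at a q : int := IntZ_eval q a.

Lemma IntZ_at_zmod_morphism a : zmod_morphism (IntZ_at a).
Proof.
by move=> q r; apply: (@intr_inj rat); rewrite rmorphB /= !IntZ_evalE rmorphB.
Qed.

Lemma IntZ_at_monoid_morphism a : monoid_morphism (IntZ_at a).
Proof.
split=> [|q r]; apply: (@intr_inj rat); first by rewrite IntZ_evalE rmorph1.
by rewrite rmorphM /= !IntZ_evalE rmorphM.
Qed.

HB.instance Definition _ a :=
  GRing.isZmodMorphism.Build (IntZ X) int (IntZ_at a) (IntZ_at_zmod_morphism a).
HB.instance Definition _ a :=
  GRing.isMonoidMorphism.Build (IntZ X) int (IntZ_at a) (IntZ_at_monoid_morphism a).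

Lemma IntZ_scalerE (n : int) q : n *: q = q *~ n. Proof. by []. Qed.

Lemma IntZ_at_scalable a n q : IntZ_at a (n *: q) = n * IntZ_at a q.
Proof. by rewrite IntZ_scalerE rmorphMz /= -mulrzl intz. Qed.

Lemma IntZ_at_var a x : IntZ_at a (IntZ_var x) = a x.
Proof. by apply: (@intr_inj rat); rewrite IntZ_evalE qeval_var. Qed.

Lemma qeval0 (q : Qpoly X) : qeval (fun=> 0) q = mcoeff mone q.
Proof.
rewrite {2}[q]monalgE raddf_sum /qeval mmapE; apply: eq_bigr => m _ /=.
rewrite mcoeffU; case: eqVneq => [->|m1]; first by rewrite /meval mdom1 big_seq_fset0 mulr1.
have [x xm] : exists x, x \in finsupp m.
  apply/fset0Pn; apply: contra_neq m1 => m0; apply/eqP/cmP => y.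
  by apply/eqP; rewrite cm1 cmE_eq0 m0.
by rewrite /meval (big_fsetD1 x) //= expr0n cmE_eq0 xm /= mul0r mulr0.
Qed.

Lemma IntZ_zero_constE q : (q \in @IntZ_zero_const X) = (IntZ_at (fun=> 0) q == 0).
Proof. by rewrite -(eqr_int rat) IntZ_evalE qeval0. Qed.

Lemma qeval_qbinom (a : X -> rat) (q : Qpoly X) n :
  qeval a (qbinom q n) = (n`!%:R)^-1 * \prod_(i < n) (qeval a q - i%:R).
Proof.
rewrite /qbinom -mul_malgC rmorphM rmorph_prod /= [X in X * _]mmapC.
by congr (_ * _); apply: eq_bigr => i _; rewrite rmorphB rmorph_nat.
Qed.

Lemma qbinom_var_intvalued x n : qbinom (qvar x) n \in @intvalued X.
Proof.
apply/asboolP => a; have [w wE] := int_fact_dvd_falling (a x) n; exists w.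
have n0 : n`!%:R != 0 :> rat by rewrite pnatr_eq0 -lt0n fact_gt0.
rewrite qeval_qbinom qeval_var; apply: (mulfI n0); rewrite mulVKf // mulr_natl.
rewrite -rmorphMn /= wE rmorph_prod; apply: eq_bigr => i _.
by rewrite rmorphB rmorph_nat.
Qed.

Definition IntZ_zeta x n : IntZ X := MkIntZ (qbinom_var_intvalued x n).

Lemma IntZ_valZ (n : int) q : IntZ_val (n *: q) = n%:~R *: IntZ_val q.
Proof. by rewrite scaler_int -(rmorphMz (val : {rmorphism IntZ X -> Qpoly X})). Qed.

Lemma IntZ_zeta_fact x n : IntZ_zeta x n *+ n`! = \prod_(i < n) (IntZ_var x - i%:R).
Proof.
apply: val_inj; rewrite rmorphMn rmorph_prod [X in X *+ _]/= /qbinom -scaler_nat scalerA mulfV.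
  by rewrite scale1r; apply: eq_bigr => i _; rewrite rmorphB rmorph_nat.
by rewrite pnatr_eq0 -lt0n fact_gt0.
Qed.

Definition IntZ_lagrange N x b : IntZ X := \sum_(k < N) newton_coef k b *: IntZ_zeta x k.

Lemma val_IntZ_lagrange N x b :
  val (IntZ_lagrange N x b) = horner_alg (qvar x) (lagrange_poly N b).
Proof.
rewrite /IntZ_lagrange /lagrange_poly !rmorph_sum /=; apply: eq_bigr => k _.
rewrite linearZ IntZ_valZ /= mulr_algl; congr (_ *: _).
rewrite /bin_poly linearZ /= mulr_algl rmorph_prod /qbinom; congr (_ *: _).
by apply: eq_bigr => i _; rewrite rmorphB /= horner_algX polyCMn rmorph_nat.
Qed.

Section Grid.
Variables (D : {fset X}) (N : nat).
Implicit Type b : {ffun D -> 'I_N}.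

Definition grid_point b : X -> nat := fun x => if insub x is Some x' then b x' else 0%N.

Definition grid_lagrange b : IntZ X := \prod_(x : D) IntZ_lagrange N (val x) (b x).

Definition grid_bounded (m : {cmonom X}) : Prop :=
  (finsupp m `<=` D)%fset /\ forall x, (m x < N)%N.

Lemma cmonom_grid_interp (m : {cmonom X}) : grid_bounded m ->
  << m >> = \sum_b meval (fun x => (grid_point b x)%:R) m *: val (grid_lagrange b)
    :> Qpoly X.
Proof.
move=> [mD mN]; rewrite (malg_cmonom_prod _ mD) big_seq_fsetE /=.
have var_interp x : qvar x ^+ m x
    = \sum_(b < N) (b%:R ^+ m x) *: val (IntZ_lagrange N x b) :> Qpoly X.
  rewrite -{1}[qvar x](horner_algX (R := rat)) -rmorphXn /=.
  rewrite (@lagrange_poly_interp N 'X^(m x)) ?size_polyXn // linear_sum.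
  by apply: eq_bigr => b _; rewrite linearZ /= mulr_algl val_IntZ_lagrange hornerXn.
under eq_bigr => x _ do rewrite -/(qvar _) var_interp.
rewrite bigA_distr_bigA; apply: eq_bigr => b _.
have -> : meval (fun x => (grid_point b x)%:R) m = \prod_(x : D) (b x)%:R ^+ m (val x).
  rewrite /meval (big_fset_incl _ mD) => [|x _]; last first.
    by rewrite -cmE_neq0 negbK => /eqP->.
  by rewrite big_seq_fsetE; apply: eq_bigr => x _; rewrite /grid_point valK.
have -> : val (grid_lagrange b) = \prod_(x : D) val (IntZ_lagrange N (val x) (b x)).
  exact: (rmorph_prod (val : {rmorphism IntZ X -> Qpoly X})).
by rewrite scaler_prod.
Qed.

Lemma IntZ_grid_interp q :
    (forall m, m \in msupp (val q) -> grid_bounded m) ->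
  q = \sum_b IntZ_at (fun x => (grid_point b x)%:Z) q *: grid_lagrange b.
Proof.
move=> qDN; apply: val_inj; rewrite rmorph_sum /=.
transitivity (\sum_b qeval (fun x => (grid_point b x)%:R) q *: val (grid_lagrange b));
  last by apply: eq_bigr => b _; rewrite IntZ_valZ IntZ_evalE.
under eq_bigr => b _ do rewrite /qeval mmapE scaler_suml.
rewrite exchange_big /= [LHS]monalgE; apply: eq_big_seq => m /qDN m_bounded.
rewrite malgUZ (cmonom_grid_interp m_bounded) scaler_sumr; apply: eq_bigr => b _.
by rewrite scalerA.
Qed.

End Grid.

Lemma grid_bounded_seq (s : seq {cmonom X}) : exists (D : {fset X}) (N : nat),
  forall m, m \in s -> grid_bounded D N m.
Proof.
exists (\bigcup_(m <- s) finsupp m)%fset, (\max_(m <- s) mdeg m).+1.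
move=> m ms; split=> [|x].
  exact: (@bigfcup_sup _ _ _ _ xpredT (fun m : {cmonom X} => finsupp m)).
rewrite ltnS; apply: (@leq_trans (mdeg m)); last first.
  exact: (@leq_bigmax_seq _ _ xpredT (fun m : {cmonom X} => mdeg m)).
have [xm|] := boolP (x \in finsupp m); last by rewrite -cmE_eq0 => /eqP->.
by rewrite mdegE (big_fsetD1 x) //= leq_addr.
Qed.

Lemma IntZ_interp (s : seq (IntZ X)) : exists (D : {fset X}) (N : nat),
  {in s, forall q, q = \sum_(b : {ffun D -> 'I_N})
    IntZ_at (fun x => (grid_point b x)%:Z) q *: grid_lagrange b}.
Proof.
have [D [N DN]] := grid_bounded_seq (flatten [seq enum_fset (msupp (val q)) | q <- s]).
exists D, N => q qs; apply: IntZ_grid_interp => m mq; apply: DN.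
by apply/flattenP; exists (enum_fset (msupp (val q))); first exact: map_f.
Qed.

Lemma IntZ_zeta_ind (S : {pred IntZ X}) : subring_closed S ->
  (forall x n, IntZ_zeta x n \in S) -> forall q, q \in S.
Proof.
move=> S_closed S_zeta q.
pose S' : subringClosed (IntZ X) := HB.pack S (GRing.isSubringClosed.Build _ S S_closed).
have [D [N qE]] := IntZ_interp [:: q].
rewrite -[_ \in S]/(q \in S') (qE q (mem_head _ _)); apply: rpred_sum => b _.
rewrite IntZ_scalerE; apply/rpredMz/rpred_prod => x _.
by apply: rpred_sum => n _; rewrite IntZ_scalerE; apply/rpredMz/S_zeta.
Qed.

End IntegerValued.

Section IntegerValuedModP.
Variables (X : choiceType) (p : nat) (p_pr : prime p).
Local Notation F := (IntF X p_pr).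
Local Notation pi := (\pi_F : {rmorphism IntZ X -> F}).
Implicit Types (q : IntZ X) (u : F) (a : X -> 'F_p).

Lemma IntF_reprK u : pi (repr u) = u.
Proof. by rewrite /= reprK. Qed.

Lemma IntF_pi_scale n q : pi (n *: q) = n%:~R *: pi q.
Proof. by rewrite scaler_int IntZ_scalerE (rmorphMz pi). Qed.

Definition Fp_lift a : X -> int := fun x => (a x : nat)%:Z.

Lemma IntZ_at_ideal q a :
  q \in @IntF_ideal X p p_pr -> (IntZ_at (Fp_lift a) q)%:~R = 0 :> 'F_p.
Proof.
move: q; apply: (lspan_ind (V := (IntZ X)^o)) => [|r g q Gg _ IHq]; first by rewrite rmorph0.
rewrite -[r *: g]/(r * g : IntZ X) !rmorphD !rmorphM /= IHq addr0.
case: Gg => [[x [n [le_pn gE]]]|->]; last by rewrite !rmorph_nat pchar_Fp_0 ?mulr0.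
have lt_an : (a x < n)%N by apply: leq_trans le_pn; rewrite -{2}(Fp_cast p_pr) ltn_ord.
suff -> : IntZ_at (Fp_lift a) g = 0 by rewrite rmorph0 mulr0.
apply: (@intr_inj rat); rewrite IntZ_evalE gE qeval_qbinom (bigD1 (Ordinal lt_an)) //=.
by rewrite qeval_var -[_%:~R]/(_%:R) subrr mul0r mulr0.
Qed.

Definition IntF_at a u : 'F_p := IntF_eval u a.

Lemma IntF_at_pi a q : IntF_at a (pi q) = (IntZ_at (Fp_lift a) q)%:~R.
Proof.
apply/eqP; rewrite -subr_eq0 -[IntF_at _ _]/((IntZ_at _ _)%:~R) -!rmorphB /=.
by apply/eqP/IntZ_at_ideal; rewrite Quotient.idealrBE; apply/eqP; rewrite reprK.
Qed.

Lemma IntF_at_zmod_morphism a : zmod_morphism (IntF_at a).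
Proof.
by move=> u v; rewrite -(IntF_reprK u) -(IntF_reprK v) -rmorphB !IntF_at_pi !rmorphB.
Qed.

Lemma IntF_at_monoid_morphism a : monoid_morphism (IntF_at a).
Proof.
split=> [|u v]; first by rewrite -(rmorph1 pi) IntF_at_pi !rmorph1.
by rewrite -(IntF_reprK u) -(IntF_reprK v) -rmorphM !IntF_at_pi !rmorphM.
Qed.

HB.instance Definition _ a :=
  GRing.isZmodMorphism.Build F 'F_p (IntF_at a) (IntF_at_zmod_morphism a).
HB.instance Definition _ a :=
  GRing.isMonoidMorphism.Build F 'F_p (IntF_at a) (IntF_at_monoid_morphism a).

Lemma IntF_at_scalable a c u : IntF_at a (c *: u) = c * IntF_at a u.
Proof.
by rewrite -[c *: u]/(u *+ (c : nat)) rmorphMn /= -mulr_natl natr_Zp.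
Qed.

Lemma IntF_at_var a x : IntF_at a (IntF_var p_pr x) = a x.
Proof.
by rewrite -[IntF_var _ _]/(pi _) IntF_at_pi IntZ_at_var /Fp_lift -pmulrn natr_Zp.
Qed.

Lemma IntF_zero_constP u : u \in @IntF_zero_const X p p_pr <-> IntF_at (fun=> 0) u = 0.
Proof.
split=> [/asboolP[r r0 <-]|u0].
  by move: r0; rewrite IntZ_zero_constE IntF_at_pi /Fp_lift => /eqP->; rewrite rmorph0.
apply/asboolP; set z := IntZ_at (Fp_lift (fun=> 0)) (repr u).
exists (repr u - z *: 1).
  by rewrite IntZ_zero_constE rmorphB /= IntZ_at_scalable rmorph1 mulr1 subrr.
rewrite -[LHS]/(pi _) rmorphB IntF_pi_scale IntF_reprK.
by rewrite -IntF_at_pi IntF_reprK u0 scale0r subr0.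
Qed.

Lemma IntF_pi_zeta_ge x n : (p <= n)%N -> pi (IntZ_zeta x n) = 0.
Proof.
move=> le_pn; rewrite -(rmorph0 pi); apply/eqP; rewrite -Quotient.idealrBE subr0.
by apply: (mem_lspan (V := (IntZ X)^o)); left; exists x, n.
Qed.

Lemma IntF_pi_lagrange_ge N x b : (p <= b)%N -> pi (IntZ_lagrange N x b) = 0.
Proof.
move=> le_pb; rewrite /IntZ_lagrange rmorph_sum big1 // => n _; rewrite IntF_pi_scale.
have [/newton_coef_gt->|le_bn] := ltnP n b; first by rewrite scale0r.
by rewrite IntF_pi_zeta_ge ?scaler0 // (leq_trans le_pb).
Qed.

(* The terms of a lattice point with a coordinate [>= p] vanish in the quotient; the
   other lattice points are lifts of their reductions modulo [p]. *)
Lemma IntF_interp (s : seq F) : exists (D : {fset X}) (N : nat),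
  {in s, forall u, u = \sum_(b : {ffun D -> 'I_N})
    IntF_at (fun x => (grid_point b x)%:R) u *: pi (grid_lagrange b)}.
Proof.
have [D [N qE]] := IntZ_interp [seq repr u | u : F <- s].
exists D, N => u us; rewrite -[LHS]IntF_reprK.
have q_s : repr u \in [seq repr u | u : F <- s] by apply: map_f.
rewrite {1}(qE _ q_s) rmorph_sum; apply: eq_bigr => b _.
rewrite IntF_pi_scale -{2}[u]IntF_reprK IntF_at_pi.
have [/existsP[x le_pb]|] := boolP [exists x : D, p <= b x]%N.
  suff -> : pi (grid_lagrange b) = 0 by rewrite !scaler0.
  by rewrite rmorph_prod (bigD1 x) //= IntF_pi_lagrange_ge ?mul0r.
rewrite negb_exists => /forallP lt_bp; congr ((IntZ_at _ _)%:~R *: _).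
apply: funext => x; rewrite /Fp_lift /grid_point; case: insubP => [x' _ _|_].
  by rewrite val_Fp_nat // modn_small // ltnNge lt_bp.
by rewrite val_Fp_nat // mod0n.
Qed.

End IntegerValuedModP.

Definition IntR_at (k : coef) (X : choiceType) (a : X -> coef_ring k) (q : IntR k X) :
  coef_ring k := IntR_eval q a.

Section IntegerValuedR.
Variables (k : coef) (X : choiceType).
Local Notation R := (coef_ring k).
Local Notation B := (IntR k X).
Implicit Types (q r : B) (a : X -> R) (c : R).

Lemma IntR_at_zmod_morphism a : zmod_morphism (@IntR_at k X a).
Proof.
by case: k a => [|p p_pr] a; [apply: IntZ_at_zmod_morphism|apply: IntF_at_zmod_morphism].
Qed.

Lemma IntR_at_monoid_morphism a : monoid_morphism (@IntR_at k X a).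
Proof.
by case: k a => [|p p_pr] a; [apply: IntZ_at_monoid_morphism|apply: IntF_at_monoid_morphism].
Qed.

Lemma IntR_at_scalable a : scalable_for *%R (@IntR_at k X a).
Proof.
by case: k a => [|p p_pr] a c q; [apply: IntZ_at_scalable|apply: IntF_at_scalable].
Qed.

HB.instance Definition _ a :=
  GRing.isZmodMorphism.Build B R (@IntR_at k X a) (IntR_at_zmod_morphism a).
HB.instance Definition _ a :=
  GRing.isMonoidMorphism.Build B R (@IntR_at k X a) (IntR_at_monoid_morphism a).
HB.instance Definition _ a :=
  GRing.isScalable.Build R B R *%R (@IntR_at k X a) (IntR_at_scalable a).

Lemma IntR_at_var a x : IntR_at a (IntR_var k x) = a x.
Proof. by case: k a => [|p p_pr] a; [apply: IntZ_at_var|apply: IntF_at_var]. Qed.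

Lemma zero_constP q : q \in @zero_const k X <-> IntR_at (fun=> 0) q = 0.
Proof.
case: k q => [|p p_pr] q; last exact: IntF_zero_constP.
by rewrite [q \in _]IntZ_zero_constE; split=> /eqP.
Qed.

End IntegerValuedR.

Lemma IntR_interpolable k (X : choiceType) : interpolable (@IntR_at k X).
Proof.
case: k => [|p p_pr] s.
  have [D [N qE]] := IntZ_interp s.
  exists {ffun D -> 'I_N}, (fun b x => (grid_point b x)%:Z), (@grid_lagrange X D N).
  exact: qE.
have [D [N qE]] := IntF_interp s; exists {ffun D -> 'I_N}.
by exists (fun b x => (grid_point b x)%:R), (fun b => \pi_(IntF X p_pr) (grid_lagrange b)).
Qed.

Lemma mem_falling (A : pzRingType) (S : {pred A}) x n : subring_closed S -> x \in S ->
  \prod_(i < n) (x - i%:R) \in S.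
Proof.
move=> S_closed; pose S' : subringClosed A :=
  HB.pack S (GRing.isSubringClosed.Build _ S S_closed).
move=> xS; suff: \prod_(i < n) (x - i%:R) \in S' by [].
by apply: rpred_prod => i _; apply: rpredB; rewrite ?rpred_nat.
Qed.

Lemma IntR_ind k (X : choiceType) (S : {pred IntR k X}) : subring_closed S ->
    (forall x, IntR_var k x \in S) -> (forall c q, c != 0 -> c *: q \in S -> q \in S) ->
  forall q, q \in S.
Proof.
case: k S => [|p p_pr] S S_closed S_var S_pure.
  apply: IntZ_zeta_ind => // x n; apply: (S_pure n`!%:R).
    by rewrite (pnatr_eq0 int) -lt0n fact_gt0.
  by rewrite scaler_nat IntZ_zeta_fact; apply: mem_falling.
pose pi := (\pi_(IntF X p_pr) : {rmorphism IntZ X -> IntF X p_pr}).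
suff: forall q, q \in [pred q | pi q \in S].
  by move=> piS q; have := piS (repr q); rewrite inE IntF_reprK.
have [S1 SB SM] := S_closed; apply: IntZ_zeta_ind => [|x n].
  by split=> [|q r|q r]; rewrite !inE ?rmorph1 // ?rmorphB ?rmorphM; [exact: SB|exact: SM].
rewrite inE; have [le_pn|lt_np] := leqP p n.
  by rewrite IntF_pi_zeta_ge // -(subrr 1) SB.
apply: (S_pure n`!%:R); first exact: Fp_fact_neq0.
rewrite scaler_nat -rmorphMn IntZ_zeta_fact rmorph_prod.
under eq_bigr => i _ do rewrite rmorphB rmorph_nat.
exact: (mem_falling n S_closed (S_var x)).
Qed.

Section AugmentationIdeal.
Variables (k : coef) (X : choiceType).
Local Notation R := (coef_ring k).
Local Notation B := (IntR k X).
Local Notation m := (maug k X).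
Local Notation M := (X -> R).
Implicit Types (q r : m) (a : M) (c : R).

Definition maug_at a q : R := IntR_at a (val q).

Lemma maug_at_scalar a : scalar (maug_at a).
Proof. by move=> c q r; rewrite /maug_at !linearP. Qed.

HB.instance Definition _ a := GRing.isLinear.Build R m R _ (maug_at a) (maug_at_scalar a).

Lemma maug_atM a q r : maug_at a (maug_mul q r) = maug_at a q * maug_at a r.
Proof. exact: rmorphM. Qed.

Lemma maug_at0 q : maug_at (fun=> 0) q = 0.
Proof. exact/zero_constP/valP. Qed.

Lemma maug_at_var a x : maug_at a (maug_var k x) = a x.
Proof. exact: IntR_at_var. Qed.

Lemma maug_mul_bilinear : is_bilinear (@maug_mul k X).
Proof.
split=> [r c q q'|q c r r']; apply: val_inj; rewrite /=.
  by rewrite mulrDl scalerAl.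
by rewrite mulrDr scalerAr.
Qed.

Lemma augment_subproof (b : B) : b - IntR_at (fun=> 0) b *: 1 \in @zero_const k X.
Proof. by apply/zero_constP; rewrite linearB linearZ_LR rmorph1 mulr1 subrr. Qed.

Definition augment (b : B) : m := MkMaug (augment_subproof b).

Lemma val_augmentK q : augment (val q) = q.
Proof. by apply: val_inj; rewrite /= [IntR_at _ _]maug_at0 scale0r subr0. Qed.

Lemma augment_linear : linear augment.
Proof.
move=> c b b'; apply: val_inj; rewrite /= linearP scalerDl -scalerA opprD addrACA.
by rewrite scalerBr.
Qed.

HB.instance Definition _ := GRing.isLinear.Build R B m _ augment augment_linear.

Lemma augment1 : augment 1 = 0.
Proof. by apply: val_inj; rewrite /= rmorph1 scale1r subrr. Qed.

Lemma augment_var x : augment (IntR_var k x) = maug_var k x.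
Proof. by apply: val_inj; rewrite /= IntR_at_var scale0r subr0. Qed.

Lemma augmentM b b' : augment (b * b') = IntR_at (fun=> 0) b *: augment b'
  + IntR_at (fun=> 0) b' *: augment b + maug_mul (augment b) (augment b').
Proof.
apply: val_inj; rewrite /= rmorphM /=; move: (IntR_at _ b) (IntR_at _ b') => c c'.
rewrite -scalerA -(mulr_algl c c'%:A) -(mulr_algl c (b' - _)) -(mulr_algl c' (b - _)).
by move: (c%:A) (c'%:A) => x x'; ring.
Qed.

Lemma maug_interpolable : interpolable maug_at.
Proof.
move=> s; have [I [a [e eE]]] := IntR_interpolable [seq val q | q <- s].
exists I, a, (augment \o e) => q qs.
rewrite -[LHS]val_augmentK {1}(eE _ (map_f _ qs)) linear_sum.
by apply: eq_bigr => i _; rewrite linearZ.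
Qed.

Lemma maug_ind (P : m -> Prop) :
    (forall c q r, P q -> P r -> P (c *: q + r)) ->
    (forall q r, P q -> P r -> P (maug_mul q r)) ->
    (forall x, P (maug_var k x)) ->
    (forall c q, c != 0 -> P (c *: q) -> P q) ->
  P 0 -> forall q, P q.
Proof.
move=> PL PM Pvar Ppure P0 q.
have PD q1 q2 : P q1 -> P q2 -> P (q1 + q2) by move=> P1 P2; rewrite -[q1]scale1r; apply: PL.
have PZ c q1 : P q1 -> P (c *: q1) by move=> P1; rewrite -[c *: q1]addr0; apply: PL.
suff: forall b, b \in [pred b | `[<P (augment b)>]].
  by move=> /(_ (val q)) /asboolP; rewrite val_augmentK.
apply: IntR_ind => [|x|c b c0].
- split=> [|b b'|b b']; first by apply/asboolP; rewrite augment1.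
    move=> /asboolP Pb /asboolP Pb'; apply/asboolP.
    by rewrite linearB -scaleN1r; exact: PD Pb (PZ _ _ Pb').
  move=> /asboolP Pb /asboolP Pb'; apply/asboolP; rewrite augmentM.
  exact: PD (PD _ _ (PZ _ _ Pb') (PZ _ _ Pb)) (PM _ _ Pb Pb').
- by apply/asboolP; rewrite augment_var.
- by move=> /asboolP; rewrite linearZ => /(Ppure _ _ c0) Pb; apply/asboolP.
Qed.

End AugmentationIdeal.

(** * Homomorphisms of cup-one algebras *)

Section UnitizedMap.
Variables (R : comNzRingType) (A B : cupone_alg R) (g : {linear A 1 -> B 1}).

Definition unitized_map (x : unitized A) : unitized B := (x.1, g x.2).

Lemma unitized_map_linear : linear unitized_map.
Proof. by move=> r x y; congr pair; apply: linearP. Qed.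

HB.instance Definition _ :=
  GRing.isLinear.Build R (unitized A) (unitized B) _ unitized_map unitized_map_linear.

Lemma unitized_map1 : unitized_map (uone A) = uone B.
Proof. by congr pair; apply: linear0. Qed.

Lemma unitized_mapM : {morph g : a b / cup1 a b} -> {morph unitized_map : x y / umul x y}.
Proof. by move=> g_cup1 x y; congr pair; rewrite /= !linearD !linearZ g_cup1. Qed.

Lemma unitized_map_inj : injective g -> injective unitized_map.
Proof. by move=> g_inj [r a] [s b] [-> /g_inj->]. Qed.

End UnitizedMap.

Lemma zeta1_morph (k : coef) (A B : cupone_alg (coef_ring k)) (g : {linear A 1 -> B 1})
    n (a : A 1) :
    {morph g : a b / cup1 a b} ->
    (exists z, z *+ n`! = falling (uone A) (@umul _ A) (0, a) n) ->
    injective (fun y : unitized B => y *+ n`!) ->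
  g (zeta1 n a) = zeta1 n (g a).
Proof.
move=> g_cup1 a_div n_inj; rewrite /zeta1; apply: (congr1 snd (x := unitized_map g _)).
exact: zeta_morph (unitized_mapM g_cup1) (unitized_map1 g) a_div n_inj.
Qed.

Lemma map_gcast (R : comNzRingType) (A B : cupone_alg R) (f : forall n, A n -> B n)
  i j (e : i = j) (u : A i) : f j (gcast e u) = gcast e (f i u).
Proof. by case: j / e. Qed.

Section CuponeHomomorphisms.
Variables (R : comNzRingType) (A B : cupone_alg R) (f : forall n, {linear A n -> B n}).

Definition cupone_hom : Prop :=
  [/\ f 0 (gr1 A) = gr1 B,
      forall i j (a : A i) (b : A j), f (i + j) (cup a b) = cup (f i a) (f j b),
      forall a b : A 1, f 1 (cup1 a b) = cup1 (f 1 a) (f 1 b),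
      forall (w : A 2) (a : A 1), f 2 (cup21 w a) = cup21 (f 2 w) (f 1 a)
    & forall v w : A 2, f 2 (circ v w) = circ (f 2 v) (f 2 w)].

Hypothesis f_hom : cupone_hom.

Lemma cupone_hom_decomp w : w \in @decomp R A -> f 2 w \in @decomp R B.
Proof.
have [_ f_cup _ _ _] := f_hom; apply: lspan_map => _ [a [b ->]].
by exists (f 1 a), (f 1 b); apply: f_cup.
Qed.

Lemma cupone_hom_leibniz i j (a : A i) (b : A j) (da : A i.+1) (db : A j.+1) :
  f _ (cup da b + (-1) ^+ i *: gcast (addnS i j) (cup a db))
    = cup (f _ da) (f _ b) + (-1) ^+ i *: gcast (addnS i j) (cup (f _ a) (f _ db)).
Proof.
have [_ f_cup _ _ _] := f_hom.
by rewrite linearD linearZ (map_gcast f) (f_cup _ _ da b) f_cup.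
Qed.

Lemma cupone_hom_cup1_d (a b : A 1) (da db : A 2) :
  f 2 (- cup a b - cup b a + cup21 da b + cup21 db a - circ da db)
    = - cup (f 1 a) (f 1 b) - cup (f 1 b) (f 1 a) + cup21 (f 2 da) (f 1 b)
      + cup21 (f 2 db) (f 1 a) - circ (f 2 da) (f 2 db).
Proof.
have [_ f_cup _ f_cup21 f_circ] := f_hom.
rewrite linearB 2!linearD linearB linearN f_circ !f_cup21.
by rewrite (f_cup _ _ a b) (f_cup _ _ b a).
Qed.

Section Pullback.
Variables (dA : degree1_map A) (dB : degree1_map B).
Hypothesis f_inj : forall n, injective (f n).

Lemma pullback_graded_algebra : is_graded_algebra B -> is_graded_algebra A.
Proof.
have [f1 f_cup _ _ _] := f_hom; move=> [cup_linl cup_linr cupA cup1l cup1r]; split.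
- by move=> i j b r a a'; apply: f_inj; rewrite linearP !f_cup linearP cup_linl.
- by move=> i j a r b b'; apply: f_inj; rewrite linearP !f_cup linearP cup_linr.
- by move=> i j l a b c; apply: f_inj; rewrite (map_gcast f) !f_cup cupA.
- by move=> i a; apply: f_inj; rewrite (f_cup 0 i) f1 cup1l.
- by move=> i a; apply: f_inj; rewrite (map_gcast f) f_cup f1 cup1r.
Qed.

Lemma pullback_unitized_comm :
  comm_algebra (uone B) (@umul R B) -> comm_algebra (uone A) (@umul R A).
Proof.
have [_ _ f_cup1 _ _] := f_hom; move=> [umulC umulA umul1 umul_lin].
have F_inj := unitized_map_inj (@f_inj 1); have FM := unitized_mapM f_cup1; split.
- by move=> x y; apply: F_inj; rewrite !FM umulC.
- by move=> x y z; apply: F_inj; rewrite !FM umulA.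
- by move=> x; apply: F_inj; rewrite FM unitized_map1 umul1.
- by move=> x r y z; apply: F_inj; rewrite FM !linearP /= !FM umul_lin.
Qed.

Hypothesis f_d : forall n (a : A n), f _ (dA a) = dB (f _ a).

Lemma pullback_d_linear : (forall n, linear (@dB n)) -> forall n, linear (@dA n).
Proof. by move=> dB_lin n r a b; apply: f_inj; rewrite linearP !f_d linearP dB_lin. Qed.

Lemma pullback_leibniz : graded_leibniz dB -> graded_leibniz dA.
Proof.
have [_ f_cup _ _ _] := f_hom; move=> leibB i j a b; apply: f_inj.
by rewrite f_d f_cup leibB cupone_hom_leibniz !f_d.
Qed.

Lemma pullback_cup1_d a b : cup1_d_formula dB (f 1 a) (f 1 b) -> cup1_d_formula dA a b.
Proof.
have [_ _ f_cup1 _ _] := f_hom; move=> cup1_dB; apply: f_inj.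
by rewrite f_d f_cup1 cup1_dB cupone_hom_cup1_d !f_d.
Qed.

Lemma pullback_dga : is_dga dB -> is_dga dA.
Proof.
move=> [B_alg dB_lin dBB leibB]; split.
- exact: pullback_graded_algebra.
- exact: pullback_d_linear.
- by move=> n a; apply: f_inj; rewrite !f_d dBB linear0.
- exact: pullback_leibniz.
Qed.

Lemma pullback_cupone_dga : is_cupone_dga dB -> is_cupone_dga dA.
Proof.
have [_ f_cup f_cup1 f_cup21 f_circ] := f_hom.
move=> [B_dga [cup1_linl cup1_linr cup21_linl cup21_linr]].
move=> [_ circ_linl circ_linr] [B_comm cup21_cup circ_cup cup1_d0 cup1_dB].
have circ_linlA r (u v w : A 2) : u \in @decomp R A -> v \in @decomp R A ->
    w \in @decomp R A -> circ (r *: u + v) w = r *: circ u w + circ v w.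
  move=> /cupone_hom_decomp Du /cupone_hom_decomp Dv /cupone_hom_decomp Dw; apply: f_inj.
  by rewrite linearP !f_circ linearP circ_linl.
have circ_linrA r (u v w : A 2) : u \in @decomp R A -> v \in @decomp R A ->
    w \in @decomp R A -> circ w (r *: u + v) = r *: circ w u + circ w v.
  move=> /cupone_hom_decomp Du /cupone_hom_decomp Dv /cupone_hom_decomp Dw; apply: f_inj.
  by rewrite linearP !f_circ linearP circ_linr.
have circ_cupA (u v w z : A 1) :
    circ (cup u v) (cup w z) = cup (cup1 u w) (cup1 v z) :> A 2.
  by apply: f_inj; rewrite f_circ !(f_cup 1 1) circ_cup !f_cup1.
split; first exact: pullback_dga.
- split.
  + by move=> b r a a'; apply: f_inj; rewrite linearP !f_cup1 linearP cup1_linl.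
  + by move=> a r b b'; apply: f_inj; rewrite linearP !f_cup1 linearP cup1_linr.
  + move=> r v w b /cupone_hom_decomp Dv /cupone_hom_decomp Dw; apply: f_inj.
    by rewrite linearP !f_cup21 linearP cup21_linl.
  + move=> w /cupone_hom_decomp Dw r a b; apply: f_inj.
    by rewrite linearP !f_cup21 linearP cup21_linr.
- by split=> //; apply: circ_decomp.
split; first exact: pullback_unitized_comm.
- by move=> a b c; apply: f_inj; rewrite f_cup21 linearD !(f_cup 1 1) !f_cup1 cup21_cup.
- exact: circ_cupA.
- by move=> a c; apply: f_inj; rewrite f_cup1 f_d cup1_d0 linearB (f_cup 1 0) (f_cup 0 1).
- move=> a b /cupone_hom_decomp Da /cupone_hom_decomp Db.
  apply: pullback_cup1_d; apply: cup1_dB.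
    by rewrite -f_d.
  by rewrite -f_d.
Qed.

End Pullback.
End CuponeHomomorphisms.

Lemma graded_leibniz_one (R : comNzRingType) (A : cupone_alg R) (d : degree1_map A) :
  is_graded_algebra A -> graded_leibniz d -> d 0 (gr1 A) = 0.
Proof.
move=> [_ _ _ cup1l cup1r] leib.
have gcast1 (e : 1%N = 1%N) (x : A 1) : gcast e x = x by rewrite /gcast eq_axiomK.
have := cup1r 1 (d 0 (gr1 A)); rewrite gcast1 => d1_cup1.
have := leib 0 0 (gr1 A) (gr1 A); rewrite (cup1l 0) expr0 scale1r gcast1 (cup1l 1) d1_cup1.
by move=> d1; apply: (addrI (d 0 (gr1 A))); rewrite addr0 -d1.
Qed.

(** * Tensors and their realization as cochains *)

Section TensorPowers.
Variables (R : comNzRingType) (U : lmodType R).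
Local Notation T := (tpow U).

Lemma tnth_tset n (t : n.-tuple U) i u j :
  tnth (tset t i u) j = if j == i then u else tnth t j.
Proof. by rewrite tnth_mktuple. Qed.

Lemma tens_multilinear n : multilinear (@tens R U n).
Proof.
move=> t i r u u'.
pose pi := \pi_(lquot (@tens_rel R U n)) :
  {additive {malg R[n.-tuple U]} -> lquot (@tens_rel R U n)}.
rewrite -[LHS]/(pi _) -[RHS]/(lquot_scale r (pi _) + pi _) lquot_scale_pi -[RHS]/(pi _ + pi _).
rewrite -raddfD; apply/eqP; rewrite -Quotient.idealrBE opprD addrA.
by apply: mem_lspan; exists t, i, r, u, u'.
Qed.

Lemma tlift_linear n (W : lmodType R) (f : n.-tuple U -> W) :
  multilinear f -> linear (tlift f).
Proof. by move=> /tlift_spec[]. Qed.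

Lemma tlift_tens n (W : lmodType R) (f : n.-tuple U -> W) t :
  multilinear f -> tlift f (tens t) = f t.
Proof. by move=> /tlift_spec[]. Qed.

(* [tlift f u] is computed on a representative of [u] that does not depend on [f]. *)
Lemma tlift_comb n (W : lmodType R) (f g : n.-tuple U -> W) c u :
  tlift (fun t => c *: f t + g t) u = c *: tlift f u + tlift g u.
Proof.
rewrite /tlift scaler_sumr -big_split; apply: eq_bigr => t _ /=.
by rewrite scalerDr !scalerA mulrC.
Qed.

Lemma tpowE n (u : T n) : u = \sum_(t <- msupp (repr u)) (repr u)@_t *: tens t.
Proof.
rewrite -[LHS]lquotK {1}[repr u]monalgE raddf_sum; apply: eq_bigr => t _ /=.
by rewrite malgUZ -lquot_scale_pi.
Qed.

Lemma tpow_ind n (P : T n -> Prop) :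
    (forall r u v, P u -> P v -> P (r *: u + v)) -> (forall t, P (tens t)) ->
  forall u, P u.
Proof.
move=> PL Pt u; have P0 : P 0.
  by have := PL (-1) _ _ (Pt [tuple 0 | i < n]) (Pt [tuple 0 | i < n]); rewrite scaleN1r addNr.
rewrite (tpowE u); elim/big_rec: _ => // t v _; exact: PL.
Qed.

Lemma tpow_ext n (W : lmodType R) (f g : T n -> W) : linear f -> linear g ->
  (forall t, f (tens t) = g (tens t)) -> f =1 g.
Proof.
by move=> f_lin g_lin fg; apply: tpow_ind => // r u v fu fv; rewrite f_lin g_lin fu fv.
Qed.

Lemma tpow_ext2 i j (W : lmodType R) (f g : T i -> T j -> W) :
    is_bilinear f -> is_bilinear g ->
  (forall s t, f (tens s) (tens t) = g (tens s) (tens t)) -> f =2 g.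
Proof.
move=> [f_linl f_linr] [g_linl g_linr] fg u v; move: u.
by apply: (tpow_ext (f_linl v) (g_linl v)) => s; apply: tpow_ext.
Qed.

Lemma tuple2E (t : 2.-tuple U) : t = [tuple tnth t ord0; tnth t ord_max].
Proof.
apply: eq_from_tnth => i; case: (unliftP ord0 i) => [j ->|->] //.
by rewrite ord1; congr tnth; apply: val_inj.
Qed.

Lemma tuple0E (t : 0.-tuple U) : t = [tuple].
Proof. exact/val_inj/size0nil/size_tuple. Qed.

Lemma bilinear_multilinear (W : lmodType R) (f : U -> U -> W) :
  is_bilinear f -> multilinear (fun t : 2.-tuple U => f (tnth t ord0) (tnth t ord_max)).
Proof.
move=> [f_linl f_linr] t i r u u'; rewrite !tnth_tset.
case: (unliftP ord0 i) => [j ->|->] /=; last exact: f_linl.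
rewrite ord1 (_ : lift ord0 ord0 = ord_max); last exact: val_inj.
exact: f_linr.
Qed.

Lemma cat_tset_l i j (s : i.-tuple U) (t : j.-tuple U) l u :
  cat_tuple (tset s l u) t = tset (cat_tuple s t) (lshift j l) u.
Proof.
apply: eq_from_tnth => n; rewrite tnth_tset; case: (split_ordP n) => n' ->.
  by rewrite !tnth_lshift tnth_tset eq_lshift.
by rewrite !tnth_rshift eq_rlshift.
Qed.

Lemma cat_tset_r i j (s : i.-tuple U) (t : j.-tuple U) l u :
  cat_tuple s (tset t l u) = tset (cat_tuple s t) (rshift i l) u.
Proof.
apply: eq_from_tnth => n; rewrite tnth_tset; case: (split_ordP n) => n' ->.
  by rewrite !tnth_lshift eq_lrshift.
by rewrite !tnth_rshift tnth_tset eq_rshift.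
Qed.

End TensorPowers.

Section TensorAlgebra.
Variables (k : coef) (X : choiceType).
Local Notation R := (coef_ring k).
Local Notation m := (maug k X).
Local Notation T := (tpow m).
Implicit Types (q r : m) (c : R).

Lemma iota1_linear : linear (@iota1 k X).
Proof.
have tsetE u : tset [tuple 0] ord0 u = [tuple u] :> 1.-tuple m.
  by apply: eq_from_tnth => i; rewrite tnth_tset !ord1.
by move=> c q r; have := tens_multilinear [tuple 0] ord0 c q r; rewrite !tsetE.
Qed.

Lemma thead_multilinear : multilinear (fun t : 1.-tuple m => thead t).
Proof. by move=> t i c q r; rewrite /thead !tnth_tset !ord1. Qed.

Lemma deg1_linear : linear (@deg1 k X).
Proof. exact/tlift_linear/thead_multilinear. Qed.

HB.instance Definition _ := GRing.isLinear.Build R m (T 1) _ (@iota1 k X) iota1_linear.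
HB.instance Definition _ := GRing.isLinear.Build R (T 1) m _ (@deg1 k X) deg1_linear.

Lemma iota1K : cancel (@iota1 k X) (@deg1 k X).
Proof. by move=> q; rewrite /deg1 tlift_tens //; apply: thead_multilinear. Qed.

Lemma deg1K : cancel (@deg1 k X) (@iota1 k X).
Proof.
apply: tpow_ext => [c u v|//|t]; first by rewrite !linearP.
rewrite /deg1 tlift_tens; last exact: thead_multilinear.
by congr tens; apply: eq_from_tnth => i; rewrite ord1.
Qed.

(* Here and below, contextual patterns prevent unification from comparing two tensors by
   unfolding them, which does not terminate in practice. *)
Lemma tcup1_iota1 q r : tcup1 (iota1 q) (iota1 r) = iota1 (maug_mul q r).
Proof. by rewrite /tcup1 [X in maug_mul X _]iota1K [X in maug_mul _ X]iota1K. Qed.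

Lemma tens2_bilinear : is_bilinear (@tens2 k X).
Proof.
have tset_l q r u : tset [tuple q; r] ord0 u = [tuple u; r] :> 2.-tuple m.
  by rewrite [LHS]tuple2E !tnth_tset.
have tset_r q r u : tset [tuple q; r] ord_max u = [tuple q; u] :> 2.-tuple m.
  by rewrite [LHS]tuple2E !tnth_tset.
split=> [r|q] c q1 q2.
  by have := tens_multilinear [tuple 0; r] ord0 c q1 q2; rewrite !tset_l.
by have := tens_multilinear [tuple q; 0] ord_max c q1 q2; rewrite !tset_r.
Qed.

Lemma tlift2_comb (W : lmodType R) (f g : m -> m -> W) c w :
  tlift2 (fun q r => c *: f q r + g q r) w = c *: tlift2 f w + tlift2 g w.
Proof. exact: tlift_comb. Qed.

Lemma tlift2_linear (W : lmodType R) (f : m -> m -> W) : is_bilinear f -> linear (tlift2 f).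
Proof. by move=> f_bil; apply/tlift_linear/bilinear_multilinear. Qed.

Lemma tlift2_tens2 (W : lmodType R) (f : m -> m -> W) q r :
  is_bilinear f -> tlift2 f (tens2 q r) = f q r.
Proof. by move=> f_bil; rewrite /tlift2 tlift_tens //; apply: bilinear_multilinear. Qed.

Section Cup.
Variables i j : nat.

Lemma tens_cat_multilinear_r (s : i.-tuple m) :
  multilinear (fun t : j.-tuple m => tens (cat_tuple s t)).
Proof. by move=> t l c q r; rewrite !cat_tset_r; apply: tens_multilinear. Qed.

Lemma tlift_tens_cat_multilinear_l (v : T j) :
  multilinear (fun s : i.-tuple m => tlift (fun t => tens (cat_tuple s t)) v).
Proof.
move=> s l c q r; rewrite -tlift_comb; congr (tlift _ v); apply: funext => t.
by rewrite !cat_tset_l; apply: tens_multilinear.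
Qed.

Lemma tcup_bilinear : is_bilinear (fun (u : T i) (v : T j) => tcup u v).
Proof.
split=> [v|u c v v']; first exact/tlift_linear/tlift_tens_cat_multilinear_l.
rewrite /tcup -tlift_comb; congr (tlift _ u); apply: funext => s.
exact/tlift_linear/tens_cat_multilinear_r.
Qed.

Lemma tcup_tens (s : i.-tuple m) (t : j.-tuple m) :
  tcup (tens s) (tens t) = tens (cat_tuple s t).
Proof.
rewrite /tcup tlift_tens; last exact: tlift_tens_cat_multilinear_l.
by rewrite tlift_tens //; apply: tens_cat_multilinear_r.
Qed.

End Cup.

Lemma tens_cons n q (t : n.-tuple m) :
  tens [tuple of q :: t] = tcup (iota1 q) (tens t) :> T n.+1.
Proof. by rewrite tcup_tens; congr tens; apply: val_inj. Qed.

Lemma tens2_mul_bilinear a b :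
  is_bilinear (fun q r => tens2 (maug_mul a q) (maug_mul b r) : T 2).
Proof.
have [tens2_linl tens2_linr] := tens2_bilinear; have [_ mul_linr] := maug_mul_bilinear k X.
by split=> [r|q] c q1 q2; rewrite mul_linr ?tens2_linl ?tens2_linr.
Qed.

Lemma tens2_derivation_bilinear a :
  is_bilinear (fun q r => tens2 (maug_mul q a) r + tens2 q (maug_mul r a) : T 2).
Proof.
have [tens2_linl tens2_linr] := tens2_bilinear; have [mul_linl _] := maug_mul_bilinear k X.
split=> [r|q] c q1 q2; rewrite mul_linl.
  by rewrite !tens2_linl scalerDr addrACA.
by rewrite !tens2_linr scalerDr addrACA.
Qed.

Lemma tcup21_linear_l (u : T 1) : linear (fun w => tcup21 w u).
Proof. exact: (tlift2_linear (tens2_derivation_bilinear (deg1 u))). Qed.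

Lemma tcup21_tens2 q r (u : T 1) : tcup21 (tens2 q r) u
  = tens2 (maug_mul q (deg1 u)) r + tens2 q (maug_mul r (deg1 u)).
Proof. exact: (tlift2_tens2 q r (tens2_derivation_bilinear (deg1 u))). Qed.

Lemma tcirc_factor_bilinear (w : T 2) : is_bilinear (fun a b =>
  tlift2 (fun q r => tens2 (maug_mul a q) (maug_mul b r) : T 2) w).
Proof.
have [tens2_linl tens2_linr] := tens2_bilinear; have [mul_linl _] := maug_mul_bilinear k X.
split=> [b|a] c q1 q2; rewrite -tlift2_comb; congr (tlift2 _ w); apply: funext => q;
  by apply: funext => r; rewrite mul_linl ?tens2_linl ?tens2_linr.
Qed.

Lemma tcirc_bilinear : is_bilinear (@tcirc k X).
Proof.
split=> [w|v c w w']; first exact: (tlift2_linear (tcirc_factor_bilinear w)).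
rewrite -[RHS]tlift2_comb; congr (tlift2 _ v); apply: funext => a; apply: funext => b.
exact: (tlift2_linear (tens2_mul_bilinear a b)).
Qed.

Lemma tcirc_tens2 a b q r :
  tcirc (tens2 a b) (tens2 q r) = tens2 (maug_mul a q) (maug_mul b r) :> T 2.
Proof.
rewrite /tcirc (tlift2_tens2 _ _ (tcirc_factor_bilinear _)).
by rewrite (tlift2_tens2 _ _ (tens2_mul_bilinear _ _)).
Qed.

End TensorAlgebra.

Section Points.
Variables (M : Type).

Definition simplex_cons n (a : M) (s : simplex M n) : simplex M n.+1 := fun j =>
  if unlift ord0 j is Some j' then s j' else a.

Definition simplex_pair (a a' : M) : simplex M 2 := fun i => if i == ord0 then a else a'.

Lemma simplex_pairE (s : simplex M 2) : s = simplex_pair (s ord0) (s ord_max).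
Proof.
apply: funext => i; rewrite /simplex_pair; case: (unliftP ord0 i) => [j ->|->] //.
by rewrite ord1; congr s; apply: val_inj.
Qed.

Lemma simplex0_eq (s s' : simplex M 0) : s = s'.
Proof. by apply: funext => -[]. Qed.

End Points.

(* Locked, so that unification does not unfold the lift to tensor powers. *)
HB.lock Definition tpow_at (k : coef) (X : choiceType) n
    (s : simplex (X -> coef_ring k) n) (u : tpow (maug k X) n) : coef_ring k :=
  tlift (W := (coef_ring k)^o) (fun t => \prod_(i < n) maug_at (s i) (tnth t i)) u.

Section Realization.
Variables (k : coef) (X : choiceType).
Local Notation R := (coef_ring k).
Local Notation m := (maug k X).
Local Notation T := (tpow m).
Local Notation M := (X -> R).
Local Notation C := (cochain R M).

Lemma prod_maug_at_multilinear n (s : simplex M n) :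
  multilinear (W := R^o) (fun t : n.-tuple m => \prod_(i < n) maug_at (s i) (tnth t i)).
Proof.
move=> t i c q r.
have prodE u : \prod_(j < n) maug_at (s j) (tnth (tset t i u) j)
    = maug_at (s i) u * \prod_(j < n | j != i) maug_at (s j) (tnth t j).
  rewrite (bigD1 i) //= tnth_tset eqxx; congr (_ * _).
  by apply: eq_bigr => j /negPf ji; rewrite tnth_tset ji.
by rewrite !prodE linearP /= mulrDl -mulrA.
Qed.

Lemma tpow_at_scalar n (s : simplex M n) : scalar (tpow_at s).
Proof. by rewrite tpow_at.unlock; apply: (tlift_linear (prod_maug_at_multilinear s)). Qed.

HB.instance Definition _ n (s : simplex M n) :=
  GRing.isLinear.Build R (T n) R _ (tpow_at s) (tpow_at_scalar s).

Lemma tpow_at_tens n (s : simplex M n) t :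
  tpow_at s (tens t) = \prod_(i < n) maug_at (s i) (tnth t i).
Proof. by rewrite tpow_at.unlock tlift_tens //; apply: prod_maug_at_multilinear. Qed.

Lemma tpow_at_iota1 (s : simplex M 1) q : tpow_at s (iota1 q) = maug_at (s ord0) q.
Proof. by rewrite tpow_at_tens big_ord1. Qed.

Lemma tpow_at_deg1 (s : simplex M 1) u : tpow_at s u = maug_at (s ord0) (deg1 u).
Proof. by rewrite -{1}[u]deg1K tpow_at_iota1. Qed.

Lemma tpow_at_tens2 (s : simplex M 2) q r :
  tpow_at s (tens2 q r) = maug_at (s ord0) q * maug_at (s ord_max) r.
Proof.
rewrite tpow_at_tens big_ord_recl big_ord1; congr (maug_at _ _ * maug_at (s _) _).
exact: val_inj.
Qed.

Lemma tpow_at_cons n a (s : simplex M n) q (t : n.-tuple m) :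
  tpow_at (simplex_cons a s) (tens [tuple of q :: t]) = maug_at a q * tpow_at s (tens t).
Proof.
rewrite !tpow_at_tens big_ord_recl /simplex_cons unlift_none; congr (_ * _).
by apply: eq_bigr => j _; rewrite liftK tnthS.
Qed.

Lemma tens_interp (l : seq m) n :
  exists (J : finType) (a : J -> simplex M n) (e : J -> n.-tuple m),
    forall t : n.-tuple m, {subset t <= l} ->
      tens t = \sum_j tpow_at (a j) (tens t) *: tens (e j).
Proof.
have [I [a [e eE]]] := maug_interpolable l.
elim: n => [|n [J [b [f fE]]]].
  exists unit, (fun _ _ _ => 0), (fun=> [tuple]) => t _.
  by rewrite (tuple0E t) (big_pred1 tt) => [|[]] //; rewrite tpow_at_tens big_ord0 scale1r.
exists (I * J)%type, (fun ij => simplex_cons (a ij.1) (b ij.2)).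
exists (fun ij => [tuple of e ij.1 :: f ij.2]) => t; case/tupleP: t => q t tl.
have qE : iota1 q = \sum_i maug_at (a i) q *: iota1 (e i).
  have /eE : q \in l by apply: tl; rewrite inE eqxx.
  move/(congr1 (@iota1 k X)) => ->; rewrite [LHS]linear_sum.
  by apply: eq_bigr => i _; rewrite [LHS]linearZ.
have tE := fE t (fun r rt => tl r (mem_behead (s := q :: t) rt)).
apply: etrans (tens_cons q t) _; apply: etrans (f_equal2 (@tcup k X 1 n) qE tE) _.
apply: etrans (bilinear_sum _ _ _ _ (tcup_bilinear k X 1 n)) _; apply: eq_bigr => ij _.
by rewrite tpow_at_cons tens_cons.
Qed.

Lemma tpow_interpolable n : interpolable (@tpow_at k X n).
Proof.
move=> s; pose ts := flatten [seq enum_fset (msupp (repr u)) | u : T n <- s].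
have [J [a [e eE]]] := tens_interp (flatten [seq tval t | t <- ts]) n.
exists J, a, (fun j => tens (e j)) => u us.
have atE p : tpow_at p u
    = \sum_(t <- msupp (repr u)) (repr u)@_t * tpow_at p (tens t).
  by rewrite {1}(tpowE u) linear_sum; apply: eq_bigr => t _; rewrite linearZ.
under eq_bigr => j _ do rewrite /= atE scaler_suml.
rewrite exchange_big [LHS]tpowE; apply: eq_big_seq => t tu.
rewrite {1}(eE t) => [|q qt]; last first.
  apply/flattenP; exists (tval t) => //; apply: map_f.
  by apply/flattenP; exists (enum_fset (msupp (repr u))); first exact: map_f.
by rewrite scaler_sumr; apply: eq_bigr => j _; rewrite scalerA.
Qed.

Definition psi n (u : T n) : C n := fun s => tpow_at s u.

Lemma psi_linear n : linear (@psi n).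
Proof. by move=> c u v; apply: funext => s; rewrite /psi linearP. Qed.

HB.instance Definition _ n := GRing.isLinear.Build R (T n) (C n) _ (@psi n) (@psi_linear n).

Lemma psi_inj n : injective (@psi n).
Proof.
move=> u v uv; apply: (interpolable_separating (@tpow_interpolable n)) => s.
exact: (congr1 (fun f : C n => f s) uv).
Qed.

Lemma psi_one : psi (tens [tuple]) = fun=> 1.
Proof. by apply: funext => s; rewrite /psi tpow_at_tens big_ord0. Qed.

Lemma psi_cup i j (u : T i) (v : T j) : psi (tcup u v) = cochain_cup (psi u) (psi v).
Proof.
move: u v; have [tcup_linl tcup_linr] := tcup_bilinear k X i j.
have [cup_linl cup_linr] := @cochain_cup_bilinear R M i j.
apply: (tpow_ext2 (f := fun u v => psi (tcup u v))
  (g := fun u v => cochain_cup (psi u) (psi v) : C (i + j))).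
- by split=> [v|u] c u1 u2; rewrite ?tcup_linl ?tcup_linr linearP.
- by split=> [v|u] c u1 u2; rewrite linearP ?cup_linl ?cup_linr.
move=> t t'; apply: funext => s; rewrite tcup_tens /cochain_cup /psi !tpow_at_tens.
rewrite big_split_ord; congr (_ * _); apply: eq_bigr => l _;
  by rewrite ?tnth_lshift ?tnth_rshift.
Qed.

Lemma psi_cup1 (u v : T 1) : psi (tcup1 u v) = cochain_cup1 (psi u) (psi v).
Proof.
apply: funext => s; rewrite /cochain_cup1 /psi tpow_at_iota1 maug_atM.
by rewrite -!tpow_at_deg1.
Qed.

Lemma psi_cup21 (w : T 2) (u : T 1) : psi (tcup21 w u) = cochain_cup21 (psi w) (psi u).
Proof.
move: w; apply: (tpow_ext (f := fun w => psi (tcup21 w u))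
  (g := fun w => cochain_cup21 (psi w) (psi u) : C 2)) => [c v w|c v w|t].
- by rewrite tcup21_linear_l linearP.
- by rewrite linearP; apply: funext => s; rewrite /cochain_cup21 !cochainE mulrDl mulrA.
rewrite [t]tuple2E; move: (tnth t _) (tnth t _) => q r; apply: funext => s.
rewrite tcup21_tens2 linearD cochainE /cochain_cup21 /psi !tpow_at_deg1.
rewrite [X in X + _ = _]tpow_at_tens2 [X in _ + X = _]tpow_at_tens2.
rewrite [X in _ = X * _]tpow_at_tens2.
by rewrite !maug_atM; ring.
Qed.

Lemma psi_circ (v w : T 2) : psi (tcirc v w) = cochain_circ (psi v) (psi w).
Proof.
move: v w; have [tcirc_linl tcirc_linr] := tcirc_bilinear k X.
have [circ_linl circ_linr] := @cochain_circ_bilinear R M.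
apply: (tpow_ext2 (f := fun v w => psi (tcirc v w))
  (g := fun v w => cochain_circ (psi v) (psi w) : C 2)).
- by split=> [w|v] c w1 w2; rewrite ?tcirc_linl ?tcirc_linr linearP.
- by split=> [w|v] c w1 w2; rewrite linearP ?circ_linl ?circ_linr.
move=> t t'; rewrite [t]tuple2E [t']tuple2E.
move: (tnth t _) (tnth t _) (tnth t' _) (tnth t' _) => a b q r; apply: funext => s.
rewrite tcirc_tens2 /cochain_circ /psi [LHS]tpow_at_tens2.
rewrite [X in _ = X * _]tpow_at_tens2 [X in _ = _ * X]tpow_at_tens2.
by rewrite !maug_atM; ring.
Qed.

Lemma psi_cupone_hom :
  cupone_hom (fun n => @psi n : {linear tensor_alg k X n -> bar_alg k X n}).
Proof.
by split; [exact: psi_one|exact: psi_cup|exact: psi_cup1|exact: psi_cup21|exact: psi_circ].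
Qed.

End Realization.

(** * The differential *)

Section TensorInduction.
Variables (k : coef) (X : choiceType).
Local Notation T := (tpow (maug k X)).
Variable P : forall n, T n -> Prop.
Hypothesis P_linear : forall n c (u v : T n), P u -> P v -> P (c *: u + v).
Hypothesis P_one : P (tens [tuple] : T 0).
Hypothesis P_cup : forall i j (u : T i) (v : T j), P u -> P v -> P (tcup u v).

Lemma tensor_alg_ind_deg1 : (forall q, P (iota1 q)) -> forall n (u : T n), P u.
Proof.
move=> P_iota1 n; apply: tpow_ind => [c u v|t]; first exact: P_linear.
elim: n t => [|n IHn] t; first by rewrite (tuple0E t).
case/tupleP: t => q t; rewrite tens_cons.
exact: (P_cup (P_iota1 q) (IHn t)).
Qed.

Lemma tensor_alg_ind : P (0 : T 1) ->
    (forall u v : T 1, P u -> P v -> P (tcup1 u v)) ->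
    (forall x, P (iota1 (maug_var k x))) ->
    (forall c (u : T 1), c != 0 -> P (c *: u) -> P u) ->
  forall n (u : T n), P u.
Proof.
move=> P0 P_cup1 P_var P_div; apply: tensor_alg_ind_deg1.
apply: maug_ind => [c q r Pq Pr|q r Pq Pr|//|c q c0|].
- by rewrite iota1_linear; apply: P_linear.
- by rewrite -tcup1_iota1; apply: P_cup1.
- by rewrite linearZ; apply: P_div.
- by rewrite linear0.
Qed.

End TensorInduction.

Section Differential.
Variables (k : coef) (X : choiceType) (tau : X -> tpow (maug k X) 2).
Local Notation R := (coef_ring k).
Local Notation M := (X -> R).
Local Notation m := (maug k X).
Local Notation T := (tpow m).
Local Notation A := (tensor_alg k X).
Local Notation B := (bar_alg k X).
Local Notation mu := (mu tau).
Local Notation zeroM := ((fun=> 0) : M).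
Local Notation psi_lin := (fun n => @psi k X n : {linear A n -> B n}).
Local Notation psi_hom := (psi_cupone_hom k X).

Lemma muE a a' x : mu a a' x = a x + a' x - tpow_at (simplex_pair a a') (tau x).
Proof.
have prod2E : (fun t : 2.-tuple m => \prod_(i < 2) maug_at (simplex_pair a a' i) (tnth t i))
    = (fun t => maug_at a (tnth t ord0) * maug_at a' (tnth t ord_max)).
  apply: funext => t; rewrite big_ord_recl big_ord1.
  by congr (_ * maug_at a' (tnth t _)); apply: val_inj.
by rewrite tpow_at.unlock prod2E.
Qed.

Lemma psi_tau x : psi (tau x) = bar_d mu (psi (iota1 (maug_var k x))).
Proof.
apply: funext => s; rewrite (bar_d_deg1 _ zeroM) /psi !tpow_at_iota1 !maug_at_var.
by rewrite muE -simplex_pairE; ring.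
Qed.

Lemma bar_d_psi_image n (u : T n) : exists w : T n.+1, psi w = bar_d mu (psi u).
Proof.
move: n u; apply: tensor_alg_ind.
- by move=> n c u v [w wE] [z zE]; exists (c *: w + z); rewrite !linearP /= wE zE.
- by exists 0; rewrite linear0 (bar_d_deg0 _ zeroM).
- move=> i j u v [w wE] [z zE].
  exists (tcup w v + (-1) ^+ i *: gcast (A := A) (addnS i j) (tcup u z)).
  rewrite [LHS](cupone_hom_leibniz psi_hom) /= wE zE psi_cup.
  exact: (esym (bar_d_leibniz mu zeroM (psi u) (psi v))).
- by exists 0; rewrite !linear0.
- move=> u v [w wE] [z zE].
  exists (- tcup u v - tcup v u + tcup21 w v + tcup21 z u - tcirc w z).
  rewrite [LHS](cupone_hom_cup1_d psi_hom) /= wE zE psi_cup1.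
  exact: (esym (bar_cup1_d mu zeroM (psi u) (psi v))).
- by move=> x; exists (tau x); apply: psi_tau.
move=> c u c0 [w]; rewrite !linearZ => wE.
have [s|z zE] := interpolable_pure (@tpow_interpolable k X 2) (v := w)
    (f := bar_d mu (psi u)) (coef_lreg c0).
  exact: (congr1 (fun f : cochain R M 2 => f s) wE).
by exists z; apply: funext => s; apply: zE.
Qed.

Definition tensor_d : degree1_map A := fun n u => sval (cid (bar_d_psi_image u)).

Lemma psi_tensor_d n (u : T n) : psi (tensor_d u) = bar_d mu (psi u).
Proof. exact: svalP (cid (bar_d_psi_image u)). Qed.

Lemma tensor_d_is_d_tau : is_d_tau tau tensor_d.
Proof.
split.
- exact: (pullback_d_linear (f := psi_lin) (@psi_inj k X) psi_tensor_d (@bar_d_linear R M mu)).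
- by move=> x; apply: psi_inj; rewrite psi_tau psi_tensor_d.
- exact: (pullback_leibniz (f := psi_lin) psi_hom (@psi_inj k X) psi_tensor_d
    (bar_d_leibniz mu zeroM)).
- move=> u v; apply: (pullback_cup1_d (f := psi_lin) psi_hom (@psi_inj k X) psi_tensor_d).
  exact: (bar_cup1_d mu zeroM).
Qed.

Lemma tensor_graded_algebra : is_graded_algebra A.
Proof.
exact: (pullback_graded_algebra psi_hom (@psi_inj k X) (bar_graded_algebra R zeroM)).
Qed.

Lemma is_d_tau_unique (d d' : degree1_map A) :
  is_d_tau tau d -> is_d_tau tau d' -> forall n (u : T n), d n u = d' n u.
Proof.
move=> [d_lin d_var leib cup1_d] [d'_lin d'_var leib' cup1_d']; apply: tensor_alg_ind.
- by move=> n c u v uE vE; rewrite (d_lin n c u v) (d'_lin n c u v) uE vE.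
- by rewrite !(graded_leibniz_one tensor_graded_algebra).
- by move=> i j u v uE vE; rewrite [LHS]leib [RHS]leib' uE vE.
- rewrite -[X in d _ X]subr0 -[X in d' _ X]subr0.
  by rewrite (zmod_morphism_linear (d_lin 1%N)) (zmod_morphism_linear (d'_lin 1%N)) !subrr.
- by move=> u v uE vE; rewrite [LHS]cup1_d [RHS]cup1_d' uE vE.
- by move=> x; rewrite d_var d'_var.
move=> c u c0; rewrite (scalable_linear (d_lin 1%N)) (scalable_linear (d'_lin 1%N)).
apply: (separating_scaler_inj _ (coef_lreg c0)).
exact/interpolable_separating/tpow_interpolable.
Qed.

Lemma d_tau_is_d_tau : is_d_tau tau (d_tau tau).
Proof.
rewrite /d_tau; case: pselect => [ex|[]]; first by case: (cid ex).
by exists tensor_d; apply: tensor_d_is_d_tau.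
Qed.

Lemma d_tau_unique : unique (is_d_tau tau) (d_tau tau).
Proof.
split=> [|d dP]; first exact: d_tau_is_d_tau.
apply: functional_extensionality_dep => n; apply: funext => u.
exact: is_d_tau_unique d_tau_is_d_tau dP n u.
Qed.

Lemma psi_d_tau n (u : T n) : psi (d_tau tau u) = d_bar tau (psi u).
Proof. by rewrite (is_d_tau_unique d_tau_is_d_tau tensor_d_is_d_tau) psi_tensor_d. Qed.

End Differential.

(** * The monomorphism *)

Section BinomialStructures.
Variables (k : coef) (X : choiceType).
Local Notation R := (coef_ring k).
Local Notation M := (X -> R).
Local Notation A := (tensor_alg k X).
Local Notation B := (bar_alg k X).
Local Notation psi_lin := (fun n => @psi k X n : {linear A n -> B n}).

Lemma bar_deg0_binomial : binomial_algebra (gr1 B) (fun a b : B 0 => cup a b : B 0).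
Proof.
apply: (@binomial_algebra_of_characters k (B 0) _ _ _ (@cochain_at R M 0)).
- by move=> f g fg; apply: funext.
- split=> // s f g; rewrite /cochain_at /=.
  by congr (f _ * g _); apply: simplex0_eq.
- by apply: full_pure_image => f; exists f.
Qed.

Lemma bar_char_pure : pure_image (@bar_char R M).
Proof.
apply: full_pure_image => f.
exists (f None, fun s => f (Some s) - f None) => -[s|] //=.
by rewrite addrC subrK.
Qed.

Lemma bar_unitized_binomial : binomial_algebra (uone B) (@umul R B).
Proof.
exact: binomial_algebra_of_characters (@bar_char_separating R M)
  (bar_char_characters R M) bar_char_pure.
Qed.

Lemma tensor_deg0_binomial : binomial_algebra (gr1 A) (fun a b : A 0 => cup a b : A 0).
Proof.
apply: (@binomial_algebra_of_characters k (A 0) _ _ _ (@tpow_at k X 0)).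
- exact/interpolable_separating/tpow_interpolable.
- split=> [s u v|s]; last exact: (congr1 (fun f : cochain R M 0 => f s) (psi_one k X)).
  apply: etrans (congr1 (fun f : cochain R M 0 => f s) (psi_cup u v)) _.
  by congr (psi u _ * psi v _); apply: simplex0_eq.
- exact/interpolable_pure/tpow_interpolable.
Qed.

Definition tensor_char (i : option (simplex M 1)) (x : unitized A) : R :=
  bar_char i (unitized_map (psi_lin 1) x : unitized B).

Lemma tensor_char_scalar i : scalar (tensor_char i).
Proof. by move=> c x y; rewrite /tensor_char !linearP. Qed.

HB.instance Definition _ i :=
  GRing.isLinear.Build R (unitized A) R _ (tensor_char i) (tensor_char_scalar i).

Lemma tensor_char_separating : separating tensor_char.
Proof.
move=> x y xy; apply: (unitized_map_inj (g := psi_lin 1) (@psi_inj k X 1)).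
exact: bar_char_separating xy.
Qed.

Lemma tensor_char_characters : characters (uone A) (@umul R A) tensor_char.
Proof.
have [bar_charM bar_char1] := bar_char_characters R M.
split=> [i x y|i]; rewrite /= /tensor_char; last by rewrite unitized_map1 bar_char1.
by rewrite (unitized_mapM (g := psi_lin 1) (@psi_cup1 k X)) bar_charM.
Qed.

Lemma tensor_char_pure : pure_image tensor_char.
Proof.
move=> c f x c_reg xE; have x1E : x.1 = c * f None := xE None.
have [s|w wE] := interpolable_pure (@tpow_interpolable k X 1) (v := x.2)
    (f := fun s => f (Some s) - f None) c_reg.
  by apply: (addrI x.1); rewrite [LHS](xE (Some s)) x1E -mulrDr addrC subrK.
exists (f None, w) => -[s|] //.
by rewrite /tensor_char /= /psi wE addrC subrK.
Qed.

Lemma tensor_unitized_binomial : binomial_algebra (uone A) (@umul R A).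
Proof.
exact: binomial_algebra_of_characters tensor_char_separating
  tensor_char_characters tensor_char_pure.
Qed.

Lemma psi_zeta1 n (u : A 1) : zeta_range k n -> psi (zeta1 n u) = zeta1 n (psi u : B 1).
Proof.
move=> n_k; apply: (zeta1_morph (g := psi_lin 1) (@psi_cup1 k X)).
- exact: (falling_divisible tensor_char_separating tensor_char_characters
    tensor_char_pure _ n_k).
- exact: (mulrn_fact_inj (@bar_char_separating R M) n_k).
Qed.

End BinomialStructures.

Section Monomorphism.
Variables (k : coef) (X : choiceType) (tau : X -> tpow (maug k X) 2).
Local Notation A := (tensor_alg k X).
Local Notation B := (bar_alg k X).

Lemma psi_morphism : is_morphism (d_tau tau) (d_bar tau) (@psi k X : forall n, A n -> B n).
Proof.
split; first by split; [exact: psi_linear|exact: psi_one].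
- exact: psi_cup.
- exact: psi_d_tau.
- exact: psi_cup1.
- exact: psi_zeta1.
Qed.

Lemma psi_extends_eval : extends_eval (@psi k X).
Proof. by move=> q s; apply: tpow_at_iota1. Qed.

Lemma morphism_extending_eval_eq (d : degree1_map A) (d' : degree1_map B)
    (f g : forall n, A n -> B n) :
    is_morphism d d' f -> is_morphism d d' g ->
    extends_eval f -> extends_eval g ->
  forall n u, f n u = g n u.
Proof.
move=> [[f_lin f1] f_cup _ _ _] [[g_lin g1] g_cup _ _ _] f_ev g_ev.
apply: tensor_alg_ind_deg1.
- by move=> n c u v uE vE; rewrite f_lin g_lin uE vE.
- by rewrite [LHS]f1 [RHS]g1.
- by move=> i j u v uE vE; rewrite [LHS]f_cup [RHS]g_cup uE vE.
- by move=> q; apply: funext => s; rewrite f_ev g_ev.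
Qed.

End Monomorphism.

Theorem theorem1p2 (k : coef) (X : choiceType) (tau : X -> tpow (maug k X) 2) :
  admissible tau ->
  [/\ unique (is_d_tau tau) (d_tau tau),
      forall n (u : tensor_alg k X n), d_tau tau (d_tau tau u) = 0,
      is_binomial_cupone_dga (d_tau tau),
      is_binomial_cupone_dga (d_bar tau)
    & exists psi : forall n, tensor_alg k X n -> bar_alg k X n,
      [/\ is_morphism (d_tau tau) (d_bar tau) psi,
          extends_eval psi,
          forall n, injective (psi n)
        & forall psi' : forall n, tensor_alg k X n -> bar_alg k X n,
            is_morphism (d_tau tau) (d_bar tau) psi' ->
            extends_eval psi' -> forall n u, psi' n u = psi n u]].
Proof.
move=> mu_assoc.
have bar_dga : is_cupone_dga (d_bar tau).
  exact: (bar_is_cupone_dga (coef_ring k) (fun=> 0) mu_assoc).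
have tensor_dga : is_cupone_dga (d_tau tau).
  exact: (pullback_cupone_dga (psi_cupone_hom k X) (@psi_inj k X) (@psi_d_tau k X tau)
    bar_dga).
split.
- exact: d_tau_unique.
- by have [[_ _ dd _] _ _ _] := tensor_dga.
- split; [exact: tensor_dga|exact: tensor_deg0_binomial|exact: tensor_unitized_binomial].
- split; [exact: bar_dga|exact: bar_deg0_binomial|exact: bar_unitized_binomial].
exists (@psi k X); split; [exact: psi_morphism|exact: psi_extends_eval|exact: psi_inj|].
move=> psi' psi'_morph psi'_ev.
exact: (morphism_extending_eval_eq psi'_morph (psi_morphism tau) psi'_ev
  (@psi_extends_eval k X)).
Qed.
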